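(* Let $n>0$ be an integer. There exists a $3$-pyramidal KTS$(6n+3)$ if and only if there exists a pertinent group $G$ of order $6n$ and a $(G,\{2^3,3\},3,1)$ difference family in $G$ which is $J$-resolvable for some subgroup $J$ of $G$ of order $2$.
   Context: A KTS$(v)$ is a set of $v$ points with a set of $3$-subsets (blocks) such that any two distinct points lie in exactly one block, together with a partition of the blocks into parallel classes, each partitioning the point set; an automorphism is a point permutation preserving blocks and mapping parallel classes to parallel classes; the KTS is $3$-pyramidal if some automorphism group fixes exactly three points and acts sharply transitively on the other $v-3$ points. Groups are written additively (not necessarily abelian), $x-y$ meaning $x+(-y)$. A finite group is pertinent if it has exactly three involutions and they are pairwise conjugate. For a $3$-subset $B=\{x,y,z\}$ of $G$, $\Delta B$ is the multiset $\{\pm(x-y),\pm(x-z),\pm(y-z)\}$ (with $-(x-y)=y-x$); for a family $\mathcal F$ of $3$-subsets, $\Delta\mathcal F$ is the multiset union of the $\Delta B$, $B\in\mathcal F$, and $\Phi(\mathcal F)$ is the multiset union of the blocks of $\mathcal F$. A $(G,\{2^3,3\},3,1)$ difference family is a family $\mathcal F$ of $3$-subsets of $G$ such that $\Delta\mathcal F$ is exactly (each element once) the set of elements of $G$ not lying in any member of $\Sigma$, where $\Sigma$ is a set consisting of three subgroups of order $2$ and one subgroup of order $3$ of $G$ with pairwise trivial intersections. For a pertinent group $G$ and a subgroup $J$ of order $2$, such an $\mathcal F$ is $J$-resolvable if there are $a,b\in G$ such that $J$, $a+J-a$, $b+J-b$ are the three subgroups of order $2$ of $G$ and $\Phi(\mathcal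 F)\cup\{0,a,b\}$ is a complete system of representatives for the left cosets $g+J$ of $J$ in $G$. *)

(* Defs.v *)
From mathcomp Require Import all_boot all_fingroup.

Set Implicit Arguments.
Unset Strict Implicit.
Unset Printing Implicit Defensive.

Local Open Scope group_scope.

Section KirkmanTripleSystem.
Variable T : finType.
Implicit Types (blocks : {set {set T}}) (classes : {set {set {set T}}}).

Definition KTS (v : nat) blocks classes : Prop :=
  [/\ #|T| = v,
      forall B : {set T}, B \in blocks -> #|B| = 3,
      forall x y : T, x != y ->
        exists! B : {set T}, [/\ B \in blocks, x \in B & y \in B],
      partition classes blocks
    & forall C : {set {set T}}, C \in classes -> partition C [set: T]].

Definition KTS_automorphism blocks classes (s : {perm T}) : Prop :=
  (forall B : {set T}, B \in blocks -> s @: B \in blocks) /\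
  (forall C : {set {set T}}, C \in classes ->
     [set s @: (B : {set T}) | B in C] \in classes).

Definition three_pyramidal blocks classes : Prop :=
  exists A : {group {perm T}},
    [/\ forall s, s \in A -> KTS_automorphism blocks classes s,
        #|'Fix_'P(A)| = 3
      & forall x y : T, x \notin 'Fix_'P(A) -> y \notin 'Fix_'P(A) ->
          exists! s : {perm T}, s \in A /\ s x = y].

End KirkmanTripleSystem.

(* Groups are multiplicative here: x - y, 0 and a + J - a of the additive
   notation become x * y^-1, 1 and J :^ a^-1 (as x ^ y = y^-1 * x * y). *)
Section DifferenceFamily.
Variable gT : finGroupType.
Implicit Types (G J : {group gT}) (B : {set gT}) (F : seq {set gT}).

Definition involutions G : {set gT} := [set x in G | #[x] == 2].

Definition pertinent G : Prop :=
  #|involutions G| = 3 /\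
  (forall x y, x \in involutions G -> y \in involutions G ->
     exists2 g, g \in G & y = x ^ g).

(* Families and multisets are sequences, compared up to permutation.  The
   differences +-(x - y), over unordered pairs of points of a block, are the
   differences over ordered pairs of distinct points. *)
Definition Delta B : seq gT := [seq x * y^-1 | x <- enum B, y <- enum (B :\ x)].

Definition DeltaF F : seq gT := flatten [seq Delta B | B <- F].

Definition Phi F : seq gT := flatten [seq enum B | B <- F].

Definition partial_spread_2_2_2_3 G (Sigma : {set {group gT}}) : Prop :=
  [/\ forall S : {group gT}, S \in Sigma -> S \subset G,
      #|Sigma| = 4,
      #|[set S : {group gT} in Sigma | #|S| == 2]| = 3,
      #|[set S : {group gT} in Sigma | #|S| == 3]| = 1%N
    & forall S S' : {group gT}, S \in Sigma -> S' \in Sigma -> S != S' ->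
        S :&: S' = 1].

Definition difference_family G F : Prop :=
  (forall B, B \in F -> B \subset G /\ #|B| = 3) /\
  exists2 Sigma : {set {group gT}}, partial_spread_2_2_2_3 G Sigma
    & perm_eq (DeltaF F) (enum (G :\: \bigcup_(S in Sigma) (S : {set gT}))).

Definition resolvable G J F : Prop :=
  exists a b : gT,
    [/\ a \in G, b \in G,
        perm_eq [:: J; (J :^ a^-1)%G; (J :^ b^-1)%G]
          (enum [set H : {group gT} | (H \subset G) && (#|H| == 2)])
      & {subset Phi F ++ [:: 1; a; b] <= G} /\
        forall C : {set gT}, C \in lcosets J G ->
          count [in C] (Phi F ++ [:: 1; a; b]) = 1%N].

End DifferenceFamily.

(* Main.v *)
Require Import Defs.
From mathcomp Require Import all_boot all_fingroup cyclic.

(** Let a group A fix the points of Fx, |Fx| = 3, and act sharply transitively on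
    the other points, which are identified with A by the choice of a base point
    x0; A then acts by right translation.  Fx is a block, and the blocks through
    a point p of Fx are {p, x, t_p x} for an involution t_p; every involution is
    some t_p, since it fixes the third point of the block through x0 and its
    translate.  The parallel class P1 of {p0, x0, t_p0 x0} has stabilizer
    {1, t_p0}; as this preserves the block of P1 through p, t_p is conjugate to
    t_p0.  The class of Fx is A-invariant, so it consists of Fx and the right
    cosets of a subgroup of order 3; every other class is a translate of P1, so
    every other block has trivial stabilizer.  Choosing one block from each
    {1, t_p0}-orbit of blocks of P1 missing Fx gives the difference family, and
    the partition of the points by P1 is its resolvability.

    Conversely P1 is rebuilt from the family, its t0-translate and the three
    cosets J, aJ, bJ completed by a point at infinity each; the other classes
    are its translates, and the right cosets of the subgroup of order 3 together
    with the block at infinity. *)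

Set Implicit Arguments.
Unset Strict Implicit.
Unset Printing Implicit Defensive.

Local Open Scope group_scope.

(** * Multisets as sequences: multiplicities in a flattened family *)

Section Sequences.
Variables (I U : eqType) (f : I -> seq U).

Lemma flatten_map_uniq (s : seq I) :
  uniq s -> (forall i, i \in s -> uniq (f i)) ->
  (forall i j x, i \in s -> j \in s -> x \in f i -> x \in f j -> i = j) ->
  uniq (flatten [seq f i | i <- s]).
Proof.
elim: s => //= i s IHs /andP[is_ us] uf inj.
rewrite cat_uniq uf ?mem_head //= IHs //; first 1 last.
- by move=> j js; apply: uf; rewrite inE js orbT.
- by move=> j k x js ks; apply: inj; rewrite inE ?js ?ks orbT.
rewrite andbT; apply/hasPn => x /flatten_mapP[j js xj]; apply/negP => xi.
have ij : i = j by apply: (inj i j x) => //; rewrite inE ?eqxx ?js ?orbT.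
by rewrite ij js in is_.
Qed.

(** Distinct [i] and [j] could both be moved to the front of [s], where [f i] and [f j] would each
    contribute at least one to the count. *)
Lemma count_flatten_map_le1 (a : pred U) (s : seq I) i j :
  count a (flatten [seq f i | i <- s]) <= 1 -> i \in s -> j \in s ->
  has a (f i) -> has a (f j) -> i = j.
Proof.
move=> le1 is_ js ai aj; apply/eqP/negPn/negP => neq_ij.
have p1 := perm_to_rem is_.
have : j \in i :: rem i s by rewrite -(perm_mem p1).
rewrite inE eq_sym (negPf neq_ij) /= => jr.
have p2 : perm_eq s [:: i, j & rem j (rem i s)].
  by apply: (perm_trans p1); rewrite perm_cons perm_to_rem.
move: le1; rewrite (seq.permP (perm_flatten (perm_map f p2))) /= !count_cat.
by rewrite leqNgt; case/negP; rewrite addnA ltn_addr // -addn1 leq_add // -has_count.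
Qed.

End Sequences.

Lemma count_le1_eq (U : eqType) (a : pred U) (s : seq U) x y :
  count a s <= 1 -> x \in s -> y \in s -> a x -> a y -> x = y.
Proof.
move=> le1 xs ys ax ay.
apply: (@count_flatten_map_le1 _ _ (fun z => [:: z]) a s) => //=; rewrite ?ax ?ay //.
by rewrite flatten_map1 map_id.
Qed.

Lemma uniq_count1 (U : eqType) (a : pred U) (s : seq U) :
  uniq s -> (exists2 x, x \in s & a x) ->
  (forall x y, x \in s -> y \in s -> a x -> a y -> x = y) -> count a s = 1%N.
Proof.
move=> us [x xs ax] inj; rewrite -size_filter.
have -> : 1%N = size [:: x] by [].
apply/perm_size/uniq_perm; rewrite ?filter_uniq // => y.
rewrite mem_filter inE; apply/andP/eqP => [[ay ys]|->//].
exact: inj.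
Qed.

(** * Partitions described pointwise, and sets of three elements *)

Section Partitions.
Variables (T : finType) (P : {set {set T}}) (D : {set T}).

Lemma partition_intro :
  set0 \notin P -> (forall B : {set T}, B \in P -> B \subset D) ->
  (forall x, x \in D -> exists2 B : {set T}, B \in P & x \in B) ->
  (forall (B C : {set T}) x, B \in P -> C \in P -> x \in B -> x \in C -> B = C) ->
  partition P D.
Proof.
move=> nP0 sPD coverP uniqP; apply/and3P; split=> //.
  rewrite eqEsubset; apply/andP; split; first exact/bigcupsP.
  by apply/subsetP=> x /coverP[B BP xB]; apply/bigcupP; exists B.
apply/trivIsetP=> B C BP CP; apply: contraR => /pred0Pn[x /andP[xB xC]].
exact/eqP/(uniqP _ _ x).
Qed.

Hypothesis partP : partition P D.

Lemma partition_uniq (B C : {set T}) x :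
  B \in P -> C \in P -> x \in B -> x \in C -> B = C.
Proof.
case/and3P: partP => _ tiP _ BP CP xB xC.
by rewrite -(def_pblock tiP BP xB) (def_pblock tiP CP xC).
Qed.

Lemma partition_ex x : x \in D -> exists2 B : {set T}, B \in P & x \in B.
Proof.
case/and3P: partP => /eqP <- _ _ xD.
by exists (pblock P x); rewrite ?pblock_mem ?mem_pblock.
Qed.

End Partitions.

Lemma cards3P (T : finType) (B : {set T}) :
  reflect (exists x y z, [/\ x != y, x != z, y != z & B = [set x; y; z]])
          (#|B| == 3).
Proof.
apply: (iffP idP) => [/eqP B3 | [x [y [z [xy xz yz ->]]]]]; last first.
  by rewrite -setUA !cardsU1 cards1 !inE negb_or xy xz yz.
have [x xB] : exists x, x \in B by apply/card_gt0P; rewrite B3.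
have /cards2P[y [z [yz Byz]]] : #|B :\ x| == 2.
  by rewrite -eqSS -B3 (cardsD1 x B) xB.
have [] : y \in B :\ x /\ z \in B :\ x by rewrite Byz !inE !eqxx orbT.
rewrite !inE => /andP[yx _] /andP[zx _]; exists x, y, z.
by rewrite eq_sym yx eq_sym zx yz -setUA -Byz setD1K.
Qed.

Lemma card3_third (T : finType) (B : {set T}) x y :
  #|B| = 3 -> x \in B -> y \in B -> x != y ->
  exists z, [/\ z != x, z != y & B = [set x; y; z]].
Proof.
move=> B3 xB yB xy.
have /eqP/cards1P[z Bz] : #|B :\ x :\ y| = 1%N.
  have := cardsD1 x B; rewrite xB (cardsD1 y (B :\ x)) !inE yB eq_sym xy B3.
  by case.
have : z \in B :\ x :\ y by rewrite Bz inE.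
rewrite !inE => /and3P[zy zx _]; exists z; split=> //.
by rewrite -setUA -Bz !setD1K // !inE eq_sym xy.
Qed.

(** * The multiset of differences of a family *)

Section Differences.
Variable gT : finGroupType.
Implicit Types (B D : {set gT}) (F : seq {set gT}) (d : gT).

Lemma DeltaFP F d :
  reflect (exists B x y, [/\ B \in F, x \in B, y \in B, x != y & d = x * y^-1])
          (d \in DeltaF F).
Proof.
apply: (iffP flatten_mapP) => [[B BF]|[B [x [y [BF xB yB xy dxy]]]]].
  case/allpairsPdep=> x [y []]; rewrite !mem_enum !inE => xB /andP[yx yB] ->.
  by exists B, x, y; rewrite eq_sym yx.
exists B => //; apply/allpairsPdep; exists x, y.
by rewrite !mem_enum !inE eq_sym xy.
Qed.

(** Asking only for [B = C] and [x = z] is enough: the equality of quotients then yields [y = w]. *)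
Lemma DeltaF_uniq F :
  uniq F ->
  (forall B C x y z w, B \in F -> C \in F -> x \in B -> y \in B -> x != y ->
     z \in C -> w \in C -> z != w -> x * y^-1 = z * w^-1 -> B = C /\ x = z) ->
  uniq (DeltaF F).
Proof.
move=> uF inj; apply: flatten_map_uniq => // [B BF|B C d BF CF]; last first.
  case/allpairsPdep=> x [y []]; rewrite !mem_enum !inE => xB /andP[yx yB] ->.
  case/allpairsPdep=> z [w []]; rewrite !mem_enum !inE => zC /andP[wz wC] e.
  by case: (inj B C x y z w); rewrite // eq_sym.
apply: flatten_map_uniq => [|x _|x z d xB zB].
- exact: enum_uniq.
- by rewrite map_inj_uniq ?enum_uniq // => y z /mulgI/invg_inj.
case/mapP=> y; rewrite !mem_enum !inE in xB zB * => /andP[yx yB] ->.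
case/mapP=> w; rewrite mem_enum !inE => /andP[wz wB] e.
by case: (inj B B x y z w); rewrite // eq_sym.
Qed.

(** [DeltaF] is a nested flattening, so the counting lemma is applied twice: over the family to
    identify the block, then inside the block to identify the first point. *)
Lemma uniq_DeltaF_inj F B C x y z w :
  uniq (DeltaF F) -> B \in F -> C \in F -> x \in B -> y \in B -> x != y ->
  z \in C -> w \in C -> z != w -> x * y^-1 = z * w^-1 -> B = C /\ x = z.
Proof.
move=> uDF BF CF xB yB xy zC wC zw e.
have hasB : has (pred1 (x * y^-1)) (Delta B).
  rewrite has_pred1; apply/allpairsPdep; exists x, y.
  by rewrite !mem_enum !inE eq_sym xy.
have eBC : B = C.
  apply: (@count_flatten_map_le1 _ _ (@Delta gT) (pred1 (x * y^-1)) F) => //.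
    by rewrite (count_uniq_mem _ uDF) leq_b1.
  rewrite has_pred1; apply/allpairsPdep; exists z, w.
  by rewrite !mem_enum !inE eq_sym zw.
split=> //; subst C.
have le1 : count (pred1 (x * y^-1)) (Delta B) <= 1.
  have p := perm_to_rem BF; move: (count_uniq_mem (x * y^-1) uDF) => c.
  have : count (pred1 (x * y^-1)) (DeltaF F) <= 1 by rewrite c leq_b1.
  rewrite (seq.permP (perm_flatten (perm_map _ p))) /= count_cat.
  exact/leq_trans/leq_addr.
apply: (@count_flatten_map_le1 _ _ (fun x => [seq x * y^-1 | y <- enum (B :\ x)])
          (pred1 (x * y^-1)) (enum B)); rewrite ?mem_enum //.
  by rewrite has_pred1; apply/mapP; exists y; rewrite // mem_enum !inE eq_sym xy.
by rewrite has_pred1; apply/mapP; exists w; rewrite // mem_enum !inE eq_sym zw.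
Qed.

End Differences.

(** * Subgroups of order 2 and the partial spread *)

Section OrderTwo.
Variable gT : finGroupType.
Implicit Types (G H J S : {group gT}) (x y : gT).

Lemma mem_cycle2 x y : #[x] = 2 -> (y \in <[x]>) = (y == 1) || (y == x).
Proof. by move=> ox; rewrite cycle2g // !inE. Qed.

Lemma cycle2_inj x y : #[x] = 2 -> #[y] = 2 -> <[x]> = <[y]> -> x = y.
Proof.
move=> ox oy e; have := cycle_id x; rewrite e mem_cycle2 //.
by rewrite -order_eq1 ox => /eqP.
Qed.

Lemma group2P S : #|S| = 2 -> exists2 x, #[x] = 2 & S = <[x]>%G.
Proof.
move=> S2; have /trivgPn[x xS x1] : (S :!=: 1) by rewrite -cardG_gt1 S2.
have ox : #[x] = 2.
  by apply/eqP; rewrite eqn_leq order_gt1 x1 andbT dvdn_leq // -S2 order_dvdG.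
exists x => //; apply/val_inj/eqP => /=; rewrite eq_sym eqEcard cycle_subG xS.
by rewrite -orderE ox S2.
Qed.

Definition subgroups2 G : {set {group gT}} :=
  [set S : {group gT} | (S \subset G) && (#|S| == 2)].

(** A subgroup of prime order 2 meets another subgroup trivially or is contained in it; containment
    contradicts Lagrange for [H] and means equality for a subgroup of order 2. *)
Lemma partial_spread_subgroups2 G H :
  H \subset G -> #|H| = 3 -> #|subgroups2 G| = 3 ->
  partial_spread_2_2_2_3 G (H |: subgroups2 G).
Proof.
move=> sHG H3 S3.
have HS : H \notin subgroups2 G by rewrite inE H3 andbF.
have TI2 S S' : S \in subgroups2 G -> S' \in H |: subgroups2 G -> S != S' ->
    S :&: S' = 1.
  rewrite !inE => /andP[_ /eqP S2] S'S neq; apply: prime_TIg; first by rewrite S2.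
  apply: contra neq => sSS'; case/orP: S'S => [/eqP S'H|/andP[_ /eqP S'2]].
    by have := cardSg sSS'; rewrite S'H S2 H3.
  by apply/eqP/val_inj/eqP; rewrite eqEcard sSS' S2 S'2.
split.
- by move=> S; rewrite !inE => /orP[/eqP->|/andP[]].
- by rewrite cardsU1 HS S3.
- rewrite -[RHS]S3; apply: eq_card => S; rewrite !inE andb_orl.
  case: (S =P H) => [->|_] /=; first by rewrite H3 !andbF.
  by rewrite -andbA andbb.
- rewrite -[RHS](cards1 H); apply: eq_card => S; rewrite !inE andb_orl.
  case: (S =P H) => [->|_] /=; first by rewrite H3.
  by case: (#|S| =P 3) => [->|_]; rewrite !andbF.
move=> S S'; rewrite in_setU1 => /orP[/eqP->|]; last exact: TI2.
rewrite in_setU1 => /orP[/eqP->|S'S]; first by rewrite eqxx.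
by move=> neq; rewrite setIC TI2 // ?setU11 // eq_sym.
Qed.

End OrderTwo.

(** * From a 3-pyramidal KTS to a difference family *)

Section FromPyramidalKTS.
Variables (T : finType) (blocks : {set {set T}}) (classes : {set {set {set T}}}).
Variable A : {group {perm T}}.
Hypothesis blocks3 : forall B : {set T}, B \in blocks -> #|B| = 3.
Hypothesis blocks_pair : forall x y : T, x != y ->
  exists! B : {set T}, [/\ B \in blocks, x \in B & y \in B].
Hypothesis classes_part : partition classes blocks.
Hypothesis class_part :
  forall C : {set {set T}}, C \in classes -> partition C [set: T].
Hypothesis autA : forall s, s \in A -> KTS_automorphism blocks classes s.
Notation Fx := 'Fix_'P(A).
Hypothesis card_Fx : #|Fx| = 3.
Hypothesis sharpA : forall x y : T, x \notin Fx -> y \notin Fx ->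
  exists! s : {perm T}, s \in A /\ s x = y.

Implicit Types (s g h : {perm T}) (B : {set T}) (C : {set {set T}}) (p x y : T).

Lemma fix_id p s : p \in Fx -> s \in A -> s p = p.
Proof. by move/afixP=> fixp /fixp. Qed.

Lemma move_nfix x s : x \notin Fx -> s \in A -> s x \notin Fx.
Proof.
move=> nx sA; apply: contra nx => fsx.
by rewrite -(permK s x) (fix_id fsx) ?groupV.
Qed.

Lemma sharp_inj x s g : x \notin Fx -> s \in A -> g \in A -> s x = g x -> s = g.
Proof.
move=> nx sA gA e; have [r [_ ru]] := sharpA nx (move_nfix nx gA).
by rewrite -(ru s) // (ru g).
Qed.

Lemma moved_nfix x s : s \in A -> s x = x -> s != 1 -> x \in Fx.
Proof.
move=> sA sx; apply: contraR => nx.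
by apply/eqP/(sharp_inj nx) => //; rewrite perm1.
Qed.

Lemma mem_perm_imset s B x : (s x \in s @: B) = (x \in B).
Proof. exact: mem_imset perm_inj. Qed.

Lemma perm_imsetM s g B : (s * g) @: B = g @: (s @: B).
Proof. by rewrite -imset_comp; apply: eq_imset => x /=; rewrite permM. Qed.

Lemma perm_imset1 B : (1 : {perm T}) @: B = B.
Proof. by rewrite -[RHS]imset_id; apply: eq_imset => x; rewrite perm1. Qed.

Lemma perm_imset3 s x y z : s @: [set x; y; z] = [set s x; s y; s z].
Proof. by rewrite !imsetU !imset_set1. Qed.

Lemma block_uniq B D x y : x != y -> B \in blocks -> D \in blocks ->
  x \in B -> y \in B -> x \in D -> y \in D -> B = D.
Proof.
move=> /blocks_pair[E [_ Eu]] Bb Db xB yB xD yD.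
by rewrite -(Eu B) // -(Eu D).
Qed.

Lemma class_block C B : C \in classes -> B \in C -> B \in blocks.
Proof.
case/and3P: classes_part => /eqP <- _ _ Cc BC.
by apply/bigcupP; exists C.
Qed.

Lemma aut_block s B : s \in A -> B \in blocks -> s @: B \in blocks.
Proof. by move/autA=> [+ _]; apply. Qed.

Lemma class_eq C B D x : C \in classes -> B \in C -> D \in C ->
  x \in B -> x \in D -> B = D.
Proof. by move/class_part=> pC; apply: (partition_uniq pC). Qed.

Lemma class_ex C x : C \in classes -> exists2 B : {set T}, B \in C & x \in B.
Proof. by move/class_part=> pC; apply: (partition_ex pC); rewrite inE. Qed.

(** The image of a class under an automorphism is a class, and a single common block identifies it.
    This is how one block decides where a whole class goes. *)
Lemma aut_class s C D B E : s \in A -> C \in classes -> D \in classes ->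
  B \in C -> s @: B \in D -> E \in C -> s @: E \in D.
Proof.
move=> sA Cc Dc BC sBD EC; have [_ /(_ C Cc) sCc] := autA sA.
have <- : [set s @: (B : {set T}) | B in C] = D.
  by apply: (partition_uniq classes_part sCc Dc _ sBD); apply: imset_f.
exact: imset_f.
Qed.

(** The block through two fixed points is preserved by [A], so its third point is fixed as well. *)
Lemma fix_block : Fx \in blocks.
Proof.
have /eqP/cards3P[p [q [r [pq _ _ FxE]]]] := card_Fx.
have [pF qF] : p \in Fx /\ q \in Fx by rewrite FxE !inE !eqxx orbT.
have [B [[Bb pB qB] Bu]] := blocks_pair pq.
suff /eqP -> : Fx == B by [].
rewrite eq_sym eqEcard card_Fx blocks3 // andbT.
have [z [zp zq BE]] := card3_third (blocks3 Bb) pB qB pq.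
suff zF : z \in Fx by rewrite BE !subUset !sub1set pF qF.
apply/afixP=> s sA /=; rewrite /aperm.
have sB : s @: B = B.
  symmetry; apply: Bu; rewrite aut_block //.
  by rewrite -{1}(fix_id pF sA) -{1}(fix_id qF sA) !mem_perm_imset.
have : s z \in B by rewrite -sB mem_perm_imset BE !inE eqxx !orbT.
rewrite BE !inE -{1}(fix_id pF sA) -{1}(fix_id qF sA) !(inj_eq perm_inj).
by rewrite (negPf zp) (negPf zq) => /eqP.
Qed.

Lemma meet_fix_block B p q :
  B \in blocks -> p != q -> p \in B -> p \in Fx -> q \in B -> q \in Fx -> B = Fx.
Proof.
by move=> Bb pq pB pF qB qF; apply: (block_uniq pq); rewrite // fix_block.
Qed.

(** * Identification of the moved points with [A]; the involutions [t p] *)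

Section BasePoint.
Variable x0 : T.
Hypothesis x0N : x0 \notin Fx.

Lemma base_inj : {in A &, injective (fun s : {perm T} => s x0)}.
Proof. by move=> s g sA gA; apply: sharp_inj. Qed.

Lemma base_ex x : x \notin Fx -> exists2 s, s \in A & x = s x0.
Proof. by move=> nx; have [s [[sA <-] _]] := sharpA x0N nx; exists s. Qed.

Lemma card_pyramidal_group : #|A| = (#|T| - 3)%N.
Proof.
rewrite -(card_in_imset base_inj) -(cardsC Fx) card_Fx addKn; apply: eq_card => x.
rewrite in_setC; apply/imsetP/idP => [[s sA ->]|/base_ex[s sA ->]].
  exact: move_nfix.
by exists s.
Qed.

(** The existential stands before the membership hypothesis so that [fin_all_exists] can extract a
    function on all of [T]; outside [Fx] its value is a dummy 1. *)
Lemma fix_involution_ex p : exists g,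
  p \in Fx -> [/\ g \in A, g != 1 & [set p; x0; g x0] \in blocks].
Proof.
have [pF|_] := boolP (p \in Fx); last by exists 1.
have px : p != x0 by apply: contraNneq x0N => <-.
have [B [[Bb pB xB] _]] := blocks_pair px.
have [z [zp zx BE]] := card3_third (blocks3 Bb) pB xB px.
have zN : z \notin Fx.
  apply: contra x0N => zF.
  by rewrite -(meet_fix_block Bb zp) // BE !inE eqxx ?orbT.
have [g gA zE] := base_ex zN; exists g => _; rewrite gA -zE -BE Bb; split=> //.
by apply: contraNneq zx => g1; rewrite zE g1 perm1.
Qed.

Variable t : T -> {perm T}.
Hypothesis tP : forall p, p \in Fx ->
  [/\ t p \in A, t p != 1 & [set p; x0; t p x0] \in blocks].

Let tA p : p \in Fx -> t p \in A. Proof. by case/tP. Qed.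

Lemma fix_neq p s : p \in Fx -> s \in A -> (s x0 == p) = false.
Proof. by move=> pF sA; apply: contraNF (move_nfix x0N sA) => /eqP->. Qed.

Lemma fix_neqC p s : p \in Fx -> s \in A -> (p == s x0) = false.
Proof. by rewrite eq_sym; apply: fix_neq. Qed.

Lemma base_eq s g : s \in A -> g \in A -> (s x0 == g x0) = (s == g).
Proof. by move=> sA gA; apply/eqP/eqP => [/base_inj->|->]. Qed.

Lemma fix_block_trans p h : p \in Fx -> h \in A ->
  [set p; h x0; (t p * h) x0] \in blocks.
Proof.
move=> pF hA; have [_ _ /(aut_block hA)] := tP pF.
by rewrite perm_imset3 (fix_id pF hA) permM.
Qed.

Lemma block_fixE p h B : p \in Fx -> h \in A -> B \in blocks ->
  p \in B -> h x0 \in B -> B = [set p; h x0; (t p * h) x0].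
Proof.
move=> pF hA Bb pB hB; apply: (@block_uniq _ _ p (h x0)) => //.
- by rewrite eq_sym fix_neq.
- exact: fix_block_trans.
- by rewrite !inE eqxx.
by rewrite !inE eqxx orbT.
Qed.

Lemma fix_involution_uniq p g : p \in Fx -> g \in A -> g != 1 ->
  [set p; x0; g x0] \in blocks -> g = t p.
Proof.
move=> pF gA g1 gb; have := block_fixE pF (group1 A) gb.
rewrite !inE !perm1 !mulg1 !eqxx orbT => /(_ isT isT)/setP/(_ (g x0)).
rewrite !inE eqxx orbT fix_neq //= -{2}(perm1 x0) !base_eq ?tA // (negPf g1) /=.
by move/esym/eqP.
Qed.

(** Translating the block [{p, x0, t p x0}] by [(t p)^-1] gives [{p, (t p)^-1 x0, x0}], and [t p] is
    the only nontrivial element defining such a block. *)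
Lemma fix_involutionV p : p \in Fx -> (t p)^-1 = t p.
Proof.
move=> pF; have [tpA tp1 _] := tP pF.
apply: fix_involution_uniq; rewrite ?groupV ?invg_eq1 //.
have := fix_block_trans pF (groupVr tpA).
by rewrite mulgV perm1 setUAC.
Qed.

Lemma fix_involution_sqr p : p \in Fx -> t p * t p = 1.
Proof. by move=> pF; rewrite -{1}fix_involutionV ?mulVg. Qed.

(** Equal involutions would put [p] and [q] on the same block through [x0] and [t q x0], which has
    only one point in [Fx]. *)
Lemma fix_involution_inj : {in Fx &, injective t}.
Proof.
move=> p q pF qF e.
have [_ tq1 bq] := tP qF.
have bp := fix_block_trans pF (group1 A); rewrite perm1 mulg1 in bp.
have x0t : x0 != t q x0 by rewrite -{1}(perm1 x0) base_eq ?tA // eq_sym.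
have := @block_uniq [set p; x0; t p x0] [set q; x0; t q x0] x0 (t q x0) x0t bp bq.
rewrite e !inE !eqxx !orbT => /(_ isT isT isT isT)/setP/(_ p).
rewrite !inE eqxx /= -{1}(perm1 x0) !fix_neqC ?tA // !orbF.
by move/esym/eqP.
Qed.

Lemma involutions_pyramidal : involutions A = t @: Fx.
Proof.
apply/setP=> g; rewrite inE; apply/andP/imsetP => [[gA /eqP og]|[p pF ->]].
  have g1 : g != 1 by rewrite -order_eq1 og.
  have gg : g * g = 1 by have := expg_order g; rewrite og expgS expg1.
  have x0g : x0 != g x0 by rewrite -{1}(perm1 x0) base_eq // eq_sym.
  have [B [[Bb xB gB] Bu]] := blocks_pair x0g.
  have ggx x : g (g x) = x by rewrite -permM gg perm1.
  have gBB : g @: B = B.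
    symmetry; apply: Bu; rewrite aut_block // mem_perm_imset xB; split=> //.
    by rewrite -(ggx x0) mem_perm_imset.
  have [z [zx zg BE]] := card3_third (blocks3 Bb) xB gB x0g.
  (* [g] exchanges [x0] and [g x0], so the only place left in [B] for the image of [z] is [z]
     itself. *)
  have : g z \in B by rewrite -gBB mem_perm_imset BE !inE eqxx !orbT.
  rewrite BE !inE (inj_eq perm_inj) (negPf zx) -{1}(ggx x0) (inj_eq perm_inj).
  rewrite (negPf zg) /= => /eqP gz.
  have zF : z \in Fx := moved_nfix gA gz g1.
  exists z => //; apply: fix_involution_uniq => //.
  by rewrite -setUA setUC -BE.
have [-> tp1 _] := tP pF; split=> //.
by rewrite (nt_prime_order (p := 2)) // expgS expg1 fix_involution_sqr.
Qed.

Lemma fix_involution_order p : p \in Fx -> #[t p] = 2.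
Proof.
move=> pF; have : t p \in involutions A.
  by rewrite involutions_pyramidal imset_f.
by rewrite inE => /andP[_ /eqP].
Qed.

Lemma disjoint_fixP B :
  reflect (forall x, x \in B -> x \notin Fx) [disjoint B & Fx].
Proof. by rewrite disjoint_subset; apply: subsetP. Qed.

Lemma disjoint_fix_notin B p : [disjoint B & Fx] -> p \in B -> p \in Fx -> False.
Proof. by move=> /disjoint_fixP dB /dB/negP. Qed.

Lemma disjoint_fix_imset s B :
  s \in A -> [disjoint B & Fx] -> [disjoint s @: B & Fx].
Proof.
move=> sA /disjoint_fixP dB; apply/disjoint_fixP => _ /imsetP[x /dB xN ->].
exact: move_nfix.
Qed.

(** Since [(g * s) x0 = s (g x0)], the action of [s] on points becomes right multiplication by [s],
    which leaves every quotient [x * y^-1] unchanged. *)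
Definition base_preim B : {set {perm T}} := [set g in A | g x0 \in B].

Lemma mem_base_preim B g : (g \in base_preim B) = (g \in A) && (g x0 \in B).
Proof. by rewrite inE. Qed.

Lemma base_preimK B :
  [disjoint B & Fx] -> [set g x0 | g : {perm T} in base_preim B] = B.
Proof.
move/disjoint_fixP=> dB; apply/setP=> x; apply/imsetP/idP => [[g]|xB].
  by rewrite mem_base_preim => /andP[_ gB] ->.
have [g gA xE] := base_ex (dB _ xB).
by exists g; rewrite // mem_base_preim gA -xE.
Qed.

Lemma card_base_preim B : [disjoint B & Fx] -> #|base_preim B| = #|B|.
Proof.
move/base_preimK=> {2}<-; rewrite card_in_imset // => g h.
by rewrite !mem_base_preim => /andP[gA _] /andP[hA _]; apply: base_inj.
Qed.

(** * The class [P1] of the block [{p0, x0, t0 x0}] and the base blocks *)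

Section BaseClass.
Variables (p0 : T) (P1 : {set {set T}}).
Hypothesis p0F : p0 \in Fx.
Hypothesis P1c : P1 \in classes.
Hypothesis b0P : [set p0; x0; t p0 x0] \in P1.
Notation t0 := (t p0).
Let t0A : t0 \in A := tA p0F.

Lemma fix_notin_base_class : Fx \notin P1.
Proof.
apply/negP => FP; have := class_eq (x := p0) P1c FP b0P p0F.
rewrite !inE eqxx => /(_ isT) e; case/negP: x0N.
by rewrite e !inE eqxx orbT.
Qed.

Lemma t0K x : t0 (t0 x) = x.
Proof. by rewrite -permM fix_involution_sqr ?perm1. Qed.

Lemma t0_imsetK B : t0 @: (t0 @: B) = B.
Proof. by rewrite -perm_imsetM fix_involution_sqr ?perm_imset1. Qed.

Lemma t0_base_class B : B \in P1 -> t0 @: B \in P1.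
Proof.
apply: (aut_class t0A P1c P1c b0P).
by rewrite perm_imset3 (fix_id p0F) // t0K setUAC.
Qed.

(** An element preserving [P1] also fixes [p0], hence preserves the block of [P1] through [p0]; so
    it sends [x0] to [x0] or to [t0 x0], and sharpness concludes. *)
Lemma base_class_stab s B :
  s \in A -> B \in P1 -> s @: B \in P1 -> s = 1 \/ s = t0.
Proof.
move=> sA BP sBP; have sbP := aut_class sA P1c P1c BP sBP b0P.
have sbE : s @: [set p0; x0; t p0 x0] = [set p0; x0; t p0 x0].
  apply: (class_eq (x := p0) P1c) => //; last by rewrite !inE eqxx.
  by rewrite -(fix_id p0F sA) mem_perm_imset !inE (fix_id p0F sA) eqxx.
have : s x0 \in [set p0; x0; t p0 x0].
  by rewrite -sbE mem_perm_imset !inE eqxx orbT.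
rewrite !inE fix_neq //= -{2}(perm1 x0) !base_eq //.
by case/orP=> /eqP->; [left | right].
Qed.

(** [r] locates the block of [P1] through [p], again with a dummy 1 outside [Fx]. These elements
    become the coset representatives 1, [a], [b] of resolvability, which is why [p0] must receive
    1. *)
Lemma base_class_fix_ex p : exists r, p \in Fx ->
  [/\ r \in A, [set p; r x0; (r * t0) x0] \in P1, t p = t0 ^ r^-1
    & p = p0 -> r = 1].
Proof.
have [->|pp0] := eqVneq p p0.
  exists 1 => _; rewrite group1 mul1g perm1; split=> //.
  by rewrite invg1 conjg1.
have [pF|_] := boolP (p \in Fx); last by exists 1.
have [B BP pB] := class_ex p P1c; have Bb := class_block P1c BP.
have [z zB zN] : exists2 z, z \in B & z \notin Fx.
  apply/subsetPn; apply: contra fix_notin_base_class => sBF.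
  suff <- : B = Fx by [].
  by apply/eqP; rewrite eqEcard sBF card_Fx blocks3.
have [r rA zE] := base_ex zN; rewrite zE in zB.
have BE := block_fixE pF rA Bb pB zB.
have t0B : t0 @: B = B.
  apply: (class_eq (x := p) P1c) => //; first exact: t0_base_class.
  by rewrite -(fix_id pF t0A) mem_perm_imset.
(* As [t0] preserves [B], the point [(r * t0) x0] lies in [B] outside [Fx]; it differs from [r x0]
   because [t0] is nontrivial, so it is the remaining point [(t p * r) x0]. *)
have rt : r * t0 = t p * r.
  have : (r * t0) x0 \in B by rewrite permM -t0B mem_perm_imset.
  rewrite BE !inE fix_neq ?groupM //= !base_eq ?groupM ?tA //.
  case/orP=> /eqP // /(canRL (mulKg r)); rewrite mulVg => t01.
  by have [_] := tP p0F; rewrite t01 eqxx.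
exists r => _; rewrite rA rt -BE; split=> //; last by move/eqP; rewrite (negPf pp0).
by rewrite conjgE invgK mulgA rt mulgK.
Qed.

(** The block of [C] through [p0] is [{p0, g x0, (t0 * g) x0}]; the inverse of [g] takes it to the
    defining block of [P1], and the rest of the class follows. *)
Lemma class_to_base C : C \in classes -> Fx \notin C ->
  exists2 h, h \in A & forall B, B \in C -> h @: B \in P1.
Proof.
move=> Cc FC; have [B BC pB] := class_ex p0 Cc; have Bb := class_block Cc BC.
have [z zB zN] : exists2 z, z \in B & z \notin Fx.
  apply/subsetPn; apply: contra FC => sBF; suff <- : B = Fx by [].
  by apply/eqP; rewrite eqEcard sBF card_Fx blocks3.
have [g gA zE] := base_ex zN; rewrite zE in zB.
have BE := block_fixE p0F gA Bb pB zB.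
exists g^-1; first by rewrite groupV.
move=> D; apply: (aut_class _ Cc P1c BC); first by rewrite groupV.
by rewrite BE perm_imset3 (fix_id p0F) ?groupV // -!permM mulgK mulgV perm1.
Qed.

(** An involution preserving a set of three points fixes one of them, and a point fixed by a
    nontrivial element of [A] lies in [Fx]. *)
Lemma t0_imset_neq B : B \in blocks -> [disjoint B & Fx] -> t0 @: B != B.
Proof.
move=> Bb /disjoint_fixP dB; apply/eqP => tB; have B3 := blocks3 Bb.
have t01 : t0 != 1 by case: (tP p0F).
have [x xB] : exists x, x \in B by apply/card_gt0P; rewrite B3.
have txB : t0 x \in B by rewrite -tB mem_perm_imset.
have xtx : x != t0 x.
  apply: contra (dB x xB) => /eqP e; exact: moved_nfix t0A (esym e) t01.
have [z [zx ztx BE]] := card3_third B3 xB txB xtx.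
have zB : z \in B by rewrite BE !inE eqxx !orbT.
have : t0 z \in B by rewrite -tB mem_perm_imset.
rewrite BE !inE (inj_eq perm_inj) (negPf zx) -{1}(t0K x) (inj_eq perm_inj).
rewrite (negPf ztx) /= => /eqP tz; case/negP: (dB z zB).
exact: moved_nfix t0A tz t01.
Qed.

(* One block out of each orbit {B, t0 B} of length two: the one whose rank in
   the enumeration of {set T} is smaller. *)
Definition base_blocks : {set {set T}} :=
  [set B in P1 | [disjoint B & Fx] & (enum_rank B < enum_rank (t0 @: B))%N].

Lemma base_blocksP B : B \in base_blocks ->
  [/\ B \in P1, B \in blocks & [disjoint B & Fx]].
Proof.
by rewrite inE => /and3P[BP dB _]; rewrite BP (class_block P1c BP).
Qed.

Lemma base_blocks_total B : B \in P1 -> [disjoint B & Fx] ->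
  B \in base_blocks \/ t0 @: B \in base_blocks.
Proof.
move=> BP dB; rewrite !inE BP dB t0_base_class // disjoint_fix_imset //=.
rewrite t0_imsetK; apply/orP; rewrite -neq_ltn; apply/eqP => /val_inj/enum_rank_inj.
by apply/eqP; rewrite eq_sym t0_imset_neq // (class_block P1c).
Qed.

(** By [base_class_stab] only [s = t0] has to be excluded, and the rank comparison cannot hold for
    both [B] and its [t0]-image. *)
Lemma base_blocks_inj B s :
  s \in A -> B \in base_blocks -> s @: B \in base_blocks -> s = 1.
Proof.
move=> sA BF sBF; have [BP _ _] := base_blocksP BF.
have [sBP _ _] := base_blocksP sBF.
have [//|st] := base_class_stab sA BP sBP; rewrite st in sBF.
move: BF sBF; rewrite !inE t0_imsetK => /and3P[_ _ lt1] /and3P[_ _ lt2].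
by have := ltn_trans lt1 lt2; rewrite ltnn.
Qed.

Definition base_family : seq {set {perm T}} :=
  [seq base_preim B | B <- enum base_blocks].

Lemma base_familyP D :
  reflect (exists2 B, B \in base_blocks & D = base_preim B) (D \in base_family).
Proof.
apply: (iffP mapP) => [[B]|[B BF ->]]; last by exists B; rewrite // mem_enum.
by rewrite mem_enum => BF ->; exists B.
Qed.

Lemma base_family_uniq : uniq base_family.
Proof.
rewrite map_inj_in_uniq ?enum_uniq // => B D; rewrite !mem_enum.
move=> /base_blocksP[_ _ dB] /base_blocksP[_ _ dD] e.
by rewrite -(base_preimK dB) e base_preimK.
Qed.

(** If [x * y^-1 = z * w^-1], right multiplication by [s = y^-1 * w] takes [x, y] to [z, w], hence
    takes the block [B] to [D]; then [base_blocks_inj] forces [s = 1]. *)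
Lemma base_family_diff_uniq : uniq (DeltaF base_family).
Proof.
apply: DeltaF_uniq base_family_uniq _ => E E' x y z w.
case/base_familyP=> B BF ->; case/base_familyP=> D DF ->.
rewrite !mem_base_preim => /andP[xA xB] /andP[yA yB] _.
move=> /andP[zA zD] /andP[wA wD] zw e.
have [[_ Bb _] [_ Db _]] := (base_blocksP BF, base_blocksP DF).
pose s := y^-1 * w; have sA : s \in A by rewrite groupM ?groupV.
have ys : y * s = w by rewrite mulKVg.
have xs : x * s = z by rewrite mulgA e mulgKV.
have sBD : s @: B = D.
  apply: (@block_uniq _ _ (z x0) (w x0)) => //.
  - by rewrite base_eq.
  - exact: aut_block.
  - by rewrite -xs permM mem_perm_imset.
  by rewrite -ys permM mem_perm_imset.
have s1 : s = 1 by apply: (base_blocks_inj sA BF); rewrite sBD.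
by rewrite -sBD -xs s1 perm_imset1 mulg1.
Qed.

(** * The class of [Fx], the subgroup of order 3, and the differences obtained *)

Section ClassAtInfinity.
Variables (Pinf : {set {set T}}) (D0 : {set T}).
Hypothesis Pinfc : Pinf \in classes.
Hypothesis FxP : Fx \in Pinf.
Hypothesis D0P : D0 \in Pinf.
Hypothesis x0D : x0 \in D0.

Lemma class_inf_inv s B : s \in A -> B \in Pinf -> s @: B \in Pinf.
Proof.
move=> sA; apply: (aut_class sA Pinfc Pinfc FxP); suff -> : s @: Fx = Fx by [].
have e : {in Fx, s =1 id} by move=> p pF; rewrite (fix_id pF).
by rewrite (eq_in_imset e) imset_id.
Qed.

Lemma D0_disjoint : [disjoint D0 & Fx].
Proof.
apply/disjoint_fixP => p pD; apply: contra x0N => pF.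
by rewrite -(class_eq Pinfc D0P FxP pD pF).
Qed.

(** [D0] and its image belong to the same invariant class and share [g x0]. So [base_preim D0] is
    the stabilizer of [D0] in [A], hence a group. *)
Lemma base_preim_stab g : g \in base_preim D0 -> g @: D0 = D0.
Proof.
rewrite mem_base_preim => /andP[gA gD].
apply: (class_eq (x := g x0) Pinfc) => //; first exact: class_inf_inv.
by rewrite mem_perm_imset.
Qed.

Lemma base_preim_group_set : group_set (base_preim D0).
Proof.
apply/group_setP; split; first by rewrite mem_base_preim group1 perm1.
move=> g h gD hD; move: (gD) (hD).
rewrite !mem_base_preim => /andP[gA gx] /andP[hA _]; rewrite groupM //=.
by rewrite permM -(base_preim_stab hD) mem_perm_imset.
Qed.
Canonical base_preim_group := Group base_preim_group_set.

(** A difference lying in the subgroup of order 3 would make [B] a translate of [D0], hence a block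
    of [Pinf]; one equal to an involution [t p] would put [p] on [B]. Conversely, for any other [d]
    the block through [x0] and [d x0] misses [Fx] and is not in [Pinf], so some [k] in [A] carries
    it to a base block, where [d = (d * k) * k^-1]. *)
Lemma mem_DeltaF_base d :
  (d \in DeltaF base_family) =
  (d \in A :\: \bigcup_(S in base_preim_group |: subgroups2 A) (S : {set _})).
Proof.
apply/DeltaFP/setDP => [[E [x [y [EF xB yB xy ->]]]]|[dA dS]].
  case/base_familyP: EF xB yB => B BF ->; rewrite !mem_base_preim.
  case/andP=> xA xB /andP[yA yB]; have [BP Bb dB] := base_blocksP BF.
  split; first by rewrite groupM ?groupV.
  apply/negP => /bigcupP[S]; rewrite 2!inE => /orP[/eqP->|].
    rewrite /= mem_base_preim => /andP[_ dD].
    have yD := class_inf_inv yA D0P; have := fix_notin_base_class.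
    rewrite (partition_uniq classes_part P1c Pinfc BP) ?FxP //.
    suff -> : B = y @: D0 by [].
    apply: (@block_uniq _ _ (x x0) (y x0)); rewrite ?base_eq //.
    - exact: class_block yD.
    - by rewrite -(mulgKV y x) permM mem_perm_imset.
    by rewrite mem_perm_imset.
  rewrite inE => /andP[sSA /eqP/group2P[g og SE]]; rewrite SE /= in sSA *.
  rewrite mem_cycle2 // -eq_mulgV1 (negPf xy) /= => /eqP dg.
  have : g \in involutions A by rewrite inE og -cycle_subG sSA.
  rewrite involutions_pyramidal => /imsetP[p pF gE].
  have := @block_uniq B [set p; y x0; (t p * y) x0] (x x0) (y x0).
  rewrite base_eq // fix_block_trans // !inE -gE -dg mulgKV !eqxx !orbT.
  move=> /(_ xy Bb isT xB yB isT isT) BE.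
  by apply: (disjoint_fix_notin dB _ pF); rewrite BE !inE eqxx.
have d1 : d != 1.
  apply: contraNneq dS => ->; apply/bigcupP.
  by exists base_preim_group; rewrite ?setU11 ?group1.
have dI : d \notin involutions A.
  apply: contra dS; rewrite inE => /andP[_ /eqP od]; apply/bigcupP.
  by exists <[d]>%G; rewrite ?cycle_id // !inE /= cycle_subG dA -orderE od orbT.
have x0d : x0 != d x0 by rewrite -{1}(perm1 x0) base_eq // eq_sym.
have [D [[Db xD dD] _]] := blocks_pair x0d.
have dDF : [disjoint D & Fx].
  apply/disjoint_fixP => p pD; apply: contra dI => pF.
  have := block_fixE pF (group1 A) Db pD; rewrite perm1 mulg1 => /(_ xD) DE.
  move: dD; rewrite DE !inE fix_neq //= eq_sym (negPf x0d) /= base_eq ?tA //.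
  move/eqP=> dt; have := involutions_pyramidal; move/setP/(_ d).
  by rewrite dt imset_f // inE => ->.
have [C Cc DC] := partition_ex classes_part Db.
have FC : Fx \notin C.
  apply: contra dS => FC; apply/bigcupP; exists base_preim_group.
    exact: setU11.
  rewrite /= mem_base_preim dA /=; suff <- : D = D0 by [].
  have CE := partition_uniq classes_part Cc Pinfc FC FxP; rewrite CE in DC.
  exact: (class_eq Pinfc DC D0P xD x0D).
have [h hA hP] := class_to_base Cc FC.
(* [h] brings [D] into [P1]; if its image is not the chosen block of its [t0]-orbit, one more
   application of [t0] makes it so. *)
have [k kA kD] : exists2 k, k \in A & k @: D \in base_blocks.
  have [hB|hB] := base_blocks_total (hP D DC) (disjoint_fix_imset hA dDF).
    by exists h.
  by exists (h * t0); rewrite ?groupM // perm_imsetM.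
exists (base_preim (k @: D)), (d * k), k; split.
- by apply/base_familyP; exists (k @: D).
- by rewrite mem_base_preim groupM // permM mem_perm_imset.
- by rewrite mem_base_preim kA mem_perm_imset.
- by rewrite -{2}(mul1g k) (inj_eq (mulIg k)).
by rewrite mulgK.
Qed.

Lemma base_family_difference :
  #|subgroups2 A| = 3 -> difference_family A base_family.
Proof.
move=> S3; split.
  move=> _ /base_familyP[B /base_blocksP[_ Bb dB] ->].
  rewrite card_base_preim // blocks3 //; split=> //.
  by apply/subsetP => g; rewrite mem_base_preim => /andP[].
exists (base_preim_group |: subgroups2 A).
  apply: partial_spread_subgroups2 => //.
    by apply/subsetP => g; rewrite mem_base_preim => /andP[].
  by rewrite /= card_base_preim ?D0_disjoint // blocks3 // (class_block Pinfc).
apply: uniq_perm; rewrite ?enum_uniq ?base_family_diff_uniq // => d.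
by rewrite mem_enum mem_DeltaF_base.
Qed.

End ClassAtInfinity.

(** * Pertinence of [A] and resolvability of the family *)

Section Resolution.
Variables (p1 p2 : T) (r : T -> {perm T}).
Hypothesis fix_uniq : uniq [:: p0; p1; p2].
Hypothesis fixE : Fx = [set p0; p1; p2].
Hypothesis rP : forall p, p \in Fx ->
  [/\ r p \in A, [set p; r p x0; (r p * t0) x0] \in P1, t p = t0 ^ (r p)^-1
    & p = p0 -> r p = 1].

Let mem_fix p : (p \in [:: p0; p1; p2]) = (p \in Fx).
Proof. by rewrite fixE !inE orbA. Qed.
Let p1F : p1 \in Fx. Proof. by rewrite -mem_fix !inE eqxx orbT. Qed.
Let p2F : p2 \in Fx. Proof. by rewrite -mem_fix !inE eqxx !orbT. Qed.
Let r0 : r p0 = 1. Proof. by case: (rP p0F) => _ _ _; apply. Qed.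
Let rA p : p \in Fx -> r p \in A. Proof. by case/rP. Qed.

Lemma pyramidal_pertinent : pertinent A.
Proof.
rewrite /pertinent involutions_pyramidal; split.
  by rewrite card_in_imset //; apply: fix_involution_inj.
move=> _ _ /imsetP[p pF ->] /imsetP[q qF ->].
have [rp _ -> _] := rP pF; have [rq _ -> _] := rP qF.
(* Conjugation by [r p] takes [t p] to [t0], and conjugation by [(r q)^-1] takes [t0] to [t q]. *)
by exists (r p * (r q)^-1); rewrite ?groupM ?groupV // -conjgM mulKg.
Qed.

Lemma subgroups2_pyramidal :
  perm_eq [:: <[t0]>%G; (<[t0]> :^ (r p1)^-1)%G; (<[t0]> :^ (r p2)^-1)%G]
    (enum (subgroups2 A)).
Proof.
have -> : [:: <[t0]>%G; (<[t0]> :^ (r p1)^-1)%G; (<[t0]> :^ (r p2)^-1)%G]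
    = [seq <[t p]>%G | p <- [:: p0; p1; p2]].
  have [_ _ t1 _] := rP p1F; have [_ _ t2 _] := rP p2F.
  by congr [:: _; _; _]; apply: val_inj => /=; rewrite -cycleJ ?t1 ?t2.
apply: uniq_perm; rewrite ?enum_uniq // ?map_inj_in_uniq //.
  move=> p q; rewrite !mem_fix => pF qF /(congr1 val)/= e.
  apply: fix_involution_inj => //; apply: cycle2_inj e;
  exact: fix_involution_order.
move=> S; rewrite mem_enum [in RHS]inE.
apply/mapP/andP => [[p]|[sSA /eqP/group2P[g og SE]]].
  rewrite mem_fix => pF -> /=; rewrite cycle_subG tA //.
  by rewrite -orderE fix_involution_order.
have : g \in involutions A by rewrite inE og -cycle_subG; rewrite SE in sSA; rewrite sSA.
rewrite involutions_pyramidal => /imsetP[p pF gE].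
by exists p; rewrite ?mem_fix // SE gE.
Qed.

Lemma mem_Phi_base g : reflect (g \in A /\ exists2 B, B \in base_blocks & g x0 \in B)
  (g \in Phi base_family).
Proof.
apply: (iffP flatten_mapP) => [[_ /base_familyP[B BF ->]]|[gA [B BF gB]]].
  by rewrite mem_enum mem_base_preim => /andP[gA gB]; split=> //; exists B.
exists (base_preim B); first by apply/base_familyP; exists B.
by rewrite mem_enum mem_base_preim gA.
Qed.

(** The block of [P1] containing [g x0] is the one through [p], so it meets [Fx], unlike a base
    block. *)
Lemma base_block_fix p B g : p \in Fx -> B \in base_blocks ->
  g x0 \in B -> g = r p \/ g = r p * t0 -> False.
Proof.
move=> pF /base_blocksP[BP _ dB] gB gE; have [rpA rpP _ _] := rP pF.
have BE : B = [set p; r p x0; (r p * t0) x0].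
  by apply: (class_eq P1c BP rpP gB); case: gE => ->; rewrite !inE eqxx ?orbT.
by apply: (disjoint_fix_notin dB _ pF); rewrite BE !inE eqxx.
Qed.

Lemma base_rep_inj p q : p \in Fx -> q \in Fx ->
  r p = r q \/ r p = r q * t0 -> p = q.
Proof.
move=> pF qF e; have [rpA rpP _ _] := rP pF; have [rqA rqP _ _] := rP qF.
have := class_eq (x := r p x0) P1c rpP rqP.
rewrite !inE eqxx orbT => /(_ isT) E.
have /setP/(_ p) : [set p; r p x0; (r p * t0) x0] = [set q; r q x0; (r q * t0) x0].
  by apply: E; case: e => ->; rewrite eqxx !orbT.
by rewrite !inE eqxx !fix_neqC ?groupM // !orbF => /esym/eqP.
Qed.

(** As [(g * t0) x0 = t0 (g x0)], the left coset of [g] corresponds to the pair [{y, t0 y}] with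
    [y = g x0]. If the block of [P1] through [y] misses [Fx], exactly one of it and its [t0]-image
    is a base block; otherwise it is the block through some [p] in [Fx], and the coset is that of
    [r p]. *)
Lemma base_family_resolvable : resolvable A <[t0]>%G base_family.
Proof.
have t01 : t0 != 1 by case: (tP p0F).
have tailE : [:: 1; r p1; r p2] = [seq r p | p <- [:: p0; p1; p2]] by rewrite /= r0.
exists (r p1), (r p2); rewrite !rA //; split=> //.
  exact: subgroups2_pyramidal.
rewrite tailE; split.
  move=> g; rewrite mem_cat => /orP[/mem_Phi_base[]//|/mapP[p]].
  by rewrite mem_fix => pF ->; rewrite rA.
move=> _ /lcosetsP[g gA ->]; apply: uniq_count1.
- rewrite cat_uniq; apply/and3P; split.
  + apply: flatten_map_uniq; first exact: base_family_uniq.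
      by move=> B _; apply: enum_uniq.
    move=> E E' h /base_familyP[B /base_blocksP[BP _ _] ->].
    move=> /base_familyP[D /base_blocksP[DP _ _] ->].
    rewrite !mem_enum !mem_base_preim => /andP[_ hB] /andP[_ hD].
    by rewrite (class_eq P1c BP DP hB hD).
  + apply/hasPn => _ /mapP[p pF ->]; rewrite mem_fix in pF.
    apply/negP => /mem_Phi_base[_ [B BF rB]].
    by apply: (base_block_fix pF BF rB); left.
  rewrite map_inj_in_uniq // => p q; rewrite !mem_fix => pF qF e.
  by apply: base_rep_inj => //; left.
(* Existence of a representative: the cases are whether the block of [P1] through [g x0] meets
   [Fx]. *)
- have [B BP gB] := class_ex (g x0) P1c.
  have gcos h : h = g \/ h = g * t0 -> h \in g *: <[t0]>.
    case=> ->; first by rewrite lcoset_refl.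
    by rewrite mem_lcoset mulKg cycle_id.
  have [dB|] := boolP [disjoint B & Fx].
    have [BF|BF] := base_blocks_total BP dB.
      exists g; last by apply: gcos; left.
      by rewrite mem_cat; apply/orP; left; apply/mem_Phi_base; split; last exists B.
    exists (g * t0); last by apply: gcos; right.
    rewrite mem_cat; apply/orP; left; apply/mem_Phi_base; split.
      by rewrite groupM.
    by exists (t0 @: B); rewrite // permM mem_perm_imset.
  case/pred0Pn => p /andP[pB pF]; rewrite /= in pB pF; have [rpA rpP _ _] := rP pF.
  exists (r p).
    by rewrite mem_cat; apply/orP; right; apply: map_f; rewrite mem_fix.
  have BE : B = [set p; r p x0; (r p * t0) x0].
    by apply: (class_eq P1c BP rpP pB); rewrite !inE eqxx.
  apply: gcos; move: gB; rewrite BE !inE fix_neq //= !base_eq ?groupM //.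
  case/orP=> /eqP gE; [by left | right].
  by rewrite gE -mulgA fix_involution_sqr // mulg1.
(* Uniqueness: apart from [x = y], the only possibility is [y = x * t0], examined according to
   whether [x] and [y] come from base blocks or from [r]. *)
move=> x y xs ys xC yC.
have : y \in x *: <[t0]> by rewrite (lcoset_eqP xC).
rewrite mem_lcoset mem_cycle2 ?fix_involution_order //.
case/orP=> [|/eqP yE]; first by rewrite -eq_invg_mul invgK => /eqP.
have {}yE : y = x * t0 by rewrite -yE mulKVg.
have xE : x = y * t0 by rewrite yE -mulgA fix_involution_sqr // mulg1.
move: xs ys; rewrite !mem_cat.
case/orP=> [/mem_Phi_base[xA [B BF xB]]|/mapP[p pF xr]];
case/orP=> [/mem_Phi_base[yA [D DF yD]]|/mapP[q qF yr]].
- have [[BP Bb _] [DP _ _]] := (base_blocksP BF, base_blocksP DF).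
  have tBD : t0 @: B = D.
    apply: (class_eq (x := y x0) P1c) => //; first exact: t0_base_class.
    by rewrite yE permM mem_perm_imset.
  by have := base_blocks_inj t0A BF; rewrite tBD => /(_ DF)/eqP; rewrite (negPf t01).
- rewrite mem_fix in qF; case: (base_block_fix qF BF xB).
  by right; rewrite -yr.
- rewrite mem_fix in pF; case: (base_block_fix pF DF yD).
  by right; rewrite -xr.
rewrite !mem_fix in pF qF; rewrite xr yr; congr (r _).
by apply: base_rep_inj => //; right; rewrite -yr -xr.
Qed.

End Resolution.
End BaseClass.
End BasePoint.
End FromPyramidalKTS.

Lemma pyramidal_KTS_difference_family n (T : finType) (blocks : {set {set T}})
    (classes : {set {set {set T}}}) :
  0 < n -> KTS (6 * n + 3) blocks classes -> three_pyramidal blocks classes ->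
  exists (gT : finGroupType) (G : {group gT}),
     [/\ pertinent G, #|G| = (6 * n)%N
       & exists2 F : seq {set gT}, difference_family G F
         & exists J : {group gT},
             [/\ J \subset G, #|J| = 2 & resolvable G J F]].
Proof.
move=> n_gt0 [cT b3 b2 pC pB] [A [autA cF shA]].
(* Positivity of [n] provides more than three points, hence a base point outside [Fx]. *)
have [x0 _ x0N] : exists2 x0, x0 \in [set: T] & x0 \notin 'Fix_'P(A).
  apply/subsetPn/negP => /subset_leq_card.
  by rewrite cardsT cT cF -[leqRHS]add0n leq_add2r leqn0 muln_eq0 /= eqn0Ngt n_gt0.
have [t tP] := fin_all_exists (fix_involution_ex b3 b2 autA cF shA x0N).
have /eqP/cards3P[p0 [p1 [p2 [p01 p02 p12 FE]]]] := cF.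
have p0F : p0 \in 'Fix_'P(A) by rewrite FE !inE eqxx.
have [t0A _ b0b] := tP p0 p0F.
have [P1 P1c b0P] := partition_ex pC b0b.
have [r rP] := fin_all_exists
  (base_class_fix_ex b3 b2 pC pB autA cF shA x0N tP p0F P1c b0P).
have FxB := fix_block b3 b2 autA cF.
have [Pinf Pinfc FxP] := partition_ex pC FxB.
have [D0 D0P x0D] := partition_ex (pB _ Pinfc) (in_setT x0).
have pu : uniq [:: p0; p1; p2] by rewrite /= !inE negb_or p01 p02 p12.
exists {perm T}, A; split.
- exact: (pyramidal_pertinent b3 b2 autA cF shA x0N tP rP).
- by rewrite (card_pyramidal_group cF shA x0N) cT addnK.
have S3 : #|subgroups2 A| = 3.
  by rewrite cardE -(perm_size (subgroups2_pyramidal b3 b2 autA shA x0N tP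
    pu FE rP)).
exists (base_family A x0 t p0 P1).
  exact: (base_family_difference b3 b2 pC pB autA cF shA x0N tP p0F P1c b0P
    Pinfc FxP D0P x0D S3).
exists <[t p0]>%G; split.
- by rewrite cycle_subG.
- exact: (fix_involution_order b3 b2 autA shA x0N tP p0F).
exact: (base_family_resolvable b3 b2 pC pB autA shA x0N tP p0F P1c b0P pu FE rP).
Qed.

(** * From a difference family to a 3-pyramidal KTS *)

Section FromDifferenceFamily.
Variables (gT : finGroupType) (t0 : gT) (t r : 'I_3 -> gT).
Variables (H : {group gT}) (F : {set {set gT}}).
Implicit Types (g h x y z : gT) (B : {set gT}) (i j : 'I_3).
(** The data are spelled out on a whole group: [trE] writes each [t i] as a conjugate of [t0] by
    [r i], the [F_diff] hypotheses say that the differences cover once each element outside [H] and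
    the [t i], and the [res] hypotheses describe how the [r i] and the blocks represent the left
    cosets [{x, x * t0}]. *)
Hypothesis t0_neq1 : t0 != 1.
Hypothesis t0_sqr : t0 * t0 = 1.
Hypothesis trE : forall i, t i * r i = r i * t0.
Hypothesis t_inj : injective t.
Hypothesis card_H : #|H| = 3.
Hypothesis tNH : forall i, t i \notin H.
Hypothesis F3 : forall B, B \in F -> #|B| = 3.
Hypothesis F_diff : forall B x y, B \in F -> x \in B -> y \in B -> x != y ->
  x * y^-1 \notin H /\ forall i, x * y^-1 <> t i.
Hypothesis F_diff_ex : forall d, d \notin H -> (forall i, d <> t i) ->
  exists B x y, [/\ B \in F, x \in B, y \in B & d = x * y^-1].
Hypothesis F_diff_inj : forall B C x y z w, B \in F -> C \in F ->
  x \in B -> y \in B -> x != y -> z \in C -> w \in C -> z != w ->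
  x * y^-1 = z * w^-1 -> B = C /\ x = z.
Hypothesis res_ex : forall x,
  (exists i, x = r i \/ x = r i * t0) \/
  (exists2 B, B \in F & x \in B \/ x * t0 \in B).
Hypothesis res_r : forall B i, B \in F -> r i \notin B /\ r i * t0 \notin B.
Hypothesis res_disj : forall B C x, B \in F -> C \in F -> x \in B -> x \in C -> B = C.
Hypothesis res_t0 : forall B C x, B \in F -> C \in F -> x \in B -> x * t0 \notin C.

(** * Points, right translations and the kinds of blocks *)

Local Notation T := (gT + 'I_3)%type.

Definition translate g (u : T) : T :=
  match u with inl x => inl (x * g) | inr i => inr i end.

Lemma translate_inj g : injective (translate g).
Proof. by move=> [x|i] [y|j] //= [/mulIg->]. Qed.

Definition translation g : {perm T} := perm (@translate_inj g).

Lemma translationM g h : translation (g * h) = translation g * translation h.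
Proof. by apply/permP=> -[x|i]; rewrite permM !permE //= mulgA. Qed.

Lemma translation1 : translation 1 = 1.
Proof. by apply/permP=> -[x|i]; rewrite !permE //= mulg1. Qed.

Definition finite_block B : {set T} := inl @: B.
(** The two finite points form an orbit of left multiplication by [t i], which commutes with right
    translations; these therefore permute the blocks through each point at infinity. *)
Definition fix_line i z : {set T} := [set inr i; inl z; inl (t i * z)].
Definition infinity_block : {set T} := inr @: [set: 'I_3].

Lemma mem_finite_block B x : (inl x \in finite_block B) = (x \in B).
Proof. by rewrite mem_imset // => y z []. Qed.

Lemma inr_finite_block B i : (inr i \in finite_block B) = false.
Proof. by apply/imsetP => -[]. Qed.

Lemma inr_infinity_block i : inr i \in infinity_block.
Proof. exact: imset_f. Qed.

Lemma inl_infinity_block x : (inl x \in infinity_block) = false.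
Proof. by apply/imsetP => -[]. Qed.

Lemma inl_fix_line x i z : (inl x \in fix_line i z) = (x == z) || (x == t i * z).
Proof. by rewrite !inE. Qed.

Lemma inr_fix_line j i z : (inr j \in fix_line i z) = (j == i).
Proof. by rewrite !inE !orbF. Qed.

Lemma finite_block_inj B C : finite_block B = finite_block C -> B = C.
Proof. by move=> e; apply/setP=> x; rewrite -!mem_finite_block e. Qed.

Lemma t0V : t0^-1 = t0.
Proof. by apply/eqP; rewrite eq_invg_mul t0_sqr. Qed.

Lemma tE i : t i = r i * t0 * (r i)^-1.
Proof. by rewrite -trE mulgK. Qed.

Lemma t_sqr i : t i * t i = 1.
Proof. by rewrite tE !mulgA mulgKV -(mulgA _ t0 t0) t0_sqr mulg1 mulgV. Qed.

Lemma t_neq1 i : t i != 1.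
Proof.
apply: contra t0_neq1; rewrite tE -eq_mulgV1 => /eqP e.
by apply/eqP/(mulgI (r i)); rewrite mulg1.
Qed.

Lemma fix_line_t i z : fix_line i (t i * z) = fix_line i z.
Proof. by rewrite /fix_line mulgA t_sqr mul1g setUAC. Qed.

Lemma fix_line_mem i z x : inl x \in fix_line i z -> fix_line i z = fix_line i x.
Proof. by rewrite inl_fix_line => /orP[] /eqP->; rewrite ?fix_line_t. Qed.

Lemma card_finite_block B : #|finite_block B| = #|B|.
Proof. by rewrite card_imset // => y z []. Qed.

Lemma card_infinity_block : #|infinity_block| = 3.
Proof. by rewrite card_imset ?cardsT ?card_ord // => y z []. Qed.

Lemma card_fix_line i z : #|fix_line i z| = 3.
Proof.
apply/eqP/cards3P; exists (inr i), (inl z), (inl (t i * z)); split=> //.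
apply/eqP=> -[] /esym/eqP; rewrite -{2}(mul1g z) (inj_eq (mulIg z)).
by rewrite (negPf (t_neq1 i)).
Qed.

Lemma translation_finite_block g B :
  translation g @: finite_block B = finite_block (B :* g).
Proof.
rewrite /finite_block -rcosetE /rcoset -!imset_comp.
by apply: eq_imset => x /=; rewrite permE.
Qed.

Lemma translation_fix_line g i z : translation g @: fix_line i z = fix_line i (z * g).
Proof. by rewrite perm_imset3 !permE /= /fix_line mulgA. Qed.

Lemma translation_infinity_block g : translation g @: infinity_block = infinity_block.
Proof. by rewrite -imset_comp; apply: eq_imset => i /=; rewrite permE. Qed.

(** Because [t i * r i = r i * t0], the finite points of [fix_line i (r i * g)] are the left coset
    [{r i, r i * t0}] translated by [g]. At [g = 1] the class is preserved by right multiplication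
    by [t0]. *)
Definition translated_class g : {set {set T}} :=
  [set fix_line i (r i * g) | i : 'I_3] :|:
  ([set finite_block (B :* g) | B in F] :|:
   [set finite_block (B :* (t0 * g)) | B in F]).

Definition infinity_class : {set {set T}} :=
  infinity_block |: [set finite_block (H :* g) | g : gT].

Definition translated_classes : {set {set {set T}}} :=
  infinity_class |: [set translated_class g | g : gT].

Definition translated_blocks := cover translated_classes.

Lemma translated_classP g (X : {set T}) :
  reflect ((exists i, X = fix_line i (r i * g)) \/
           exists B k, [/\ B \in F, k = 1 \/ k = t0 & X = finite_block (B :* (k * g))])
          (X \in translated_class g).
Proof.
rewrite !inE; apply: (iffP or3P) => [[]/imsetP[B BF ->]|[[i ->]|[B [k [BF [->|->] ->]]]]].
- by left; exists B.
- by right; exists B, 1; rewrite mul1g; split; auto.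
- by right; exists B, t0; split; auto.
- by constructor 1; apply: imset_f.
- by constructor 2; rewrite mul1g; apply: (imset_f (fun B => finite_block (B :* g))).
by constructor 3; apply: (imset_f (fun B => finite_block (B :* (t0 * g)))).
Qed.

Lemma infinity_classP (X : {set T}) :
  reflect (X = infinity_block \/ exists g, X = finite_block (H :* g))
          (X \in infinity_class).
Proof.
rewrite 2!inE; apply: (iffP orP) => -[].
- by move/eqP; left.
- by case/imsetP=> g _ ->; right; exists g.
- by move->; left.
by case=> g ->; right; apply/imsetP; exists g.
Qed.

Lemma translated_classesP (C : {set {set T}}) :
  reflect (C = infinity_class \/ exists g, C = translated_class g)
          (C \in translated_classes).
Proof.
rewrite 2!inE; apply: (iffP orP) => -[].
- by move/eqP; left.
- by case/imsetP=> g _ ->; right; exists g.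
- by move->; left.
by case=> g ->; right; apply/imsetP; exists g.
Qed.

(** The factor [t0] exchanges the two halves coming from [F] and preserves each coset
    [{r i, r i * t0}]. *)
Lemma translated_class_t0 g : translated_class (t0 * g) = translated_class g.
Proof.
rewrite /translated_class mulgA t0_sqr mul1g [X in _ :|: X]setUC; congr (_ :|: _).
by apply: eq_imset => i; rewrite mulgA -trE -mulgA fix_line_t.
Qed.

Lemma translated_blocksP (X : {set T}) :
  reflect [\/ X = infinity_block, exists i z, X = fix_line i z,
              exists z, X = finite_block (H :* z)
            | exists B g, B \in F /\ X = finite_block (B :* g)]
          (X \in translated_blocks).
Proof.
apply: (iffP bigcupP) => [[C /translated_classesP[->|[g ->]]]|].
- by case/infinity_classP => [|[g]] ->; [constructor 1 | constructor 3; exists g].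
- case/translated_classP => [[i ->]|[B [k [BF _ ->]]]].
    by constructor 2; exists i, (r i * g).
  by constructor 4; exists B, (k * g).
case=> [->|[i [z ->]]|[z ->]|[B [g [BF ->]]]].
- exists infinity_class; first by apply/translated_classesP; left.
  by apply/infinity_classP; left.
- exists (translated_class ((r i)^-1 * z)).
    by apply/translated_classesP; right; eexists.
  by apply/translated_classP; left; exists i; rewrite mulKVg.
- exists infinity_class; first by apply/translated_classesP; left.
  by apply/infinity_classP; right; exists z.
exists (translated_class g); first by apply/translated_classesP; right; eexists.
by apply/translated_classP; right; exists B, 1; rewrite mul1g; split; auto.
Qed.

(** * Every pair of points lies in exactly one block *)

Lemma card_translated_block (X : {set T}) : X \in translated_blocks -> #|X| = 3.
Proof.
case/translated_blocksP => [->|[i [z ->]]|[z ->]|[B [g [BF ->]]]].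
- exact: card_infinity_block.
- exact: card_fix_line.
- by rewrite card_finite_block card_rcoset.
by rewrite card_finite_block card_rcoset F3.
Qed.

Lemma block_inr_inr (X : {set T}) i j : X \in translated_blocks ->
  i != j -> inr i \in X -> inr j \in X -> X = infinity_block.
Proof.
move=> /translated_blocksP[->|[k [z ->]]|[z ->]|[B [g [BF ->]]]] //;
  rewrite ?inr_finite_block // !inr_fix_line.
by move=> /[swap] /eqP-> /[swap] /eqP->; rewrite eqxx.
Qed.

Lemma block_inr_inl (X : {set T}) i x : X \in translated_blocks ->
  inr i \in X -> inl x \in X -> X = fix_line i x.
Proof.
move=> /translated_blocksP[->|[k [z ->]]|[z ->]|[B [g [BF ->]]]];
  rewrite ?inr_finite_block ?inl_infinity_block // inr_fix_line.
by move/eqP->; apply: fix_line_mem.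
Qed.

Lemma block_inl_inl (X : {set T}) x y : X \in translated_blocks ->
  x != y -> inl x \in X -> inl y \in X ->
  [\/ exists2 i, x * y^-1 = t i & X = fix_line i x,
      x * y^-1 \in H /\ X = finite_block (H :* x)
    | exists B g, [/\ B \in F, x * g^-1 \in B, y * g^-1 \in B
                    & X = finite_block (B :* g)]].
Proof.
move=> Xb xy; case/translated_blocksP: Xb => [->|[i [z ->]]|[z ->]|[B [g [BF ->]]]].
- by rewrite inl_infinity_block.
- move=> xX yX; constructor 1; exists i; last exact: fix_line_mem.
  rewrite !inl_fix_line in xX yX.
  case/orP: xX xy => /eqP->; case/orP: yX => /eqP->; rewrite ?eqxx // => _.
    by rewrite invMg mulKVg; apply/eqP; rewrite eq_invg_mul t_sqr.
  by rewrite mulgK.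
- rewrite !mem_finite_block => xX yX; constructor 2; split; last first.
    by congr finite_block; apply/esym/rcoset_eqP.
  by rewrite -mem_rcoset (rcoset_eqP yX).
rewrite !mem_finite_block !mem_rcoset => xX yX.
by constructor 3; exists B, g.
Qed.

(** For two finite points the quotient [x * y^-1], invariant under right translation, decides the
    kind of block: some [t i], an element of [H], or a difference of [F]. The kinds exclude each
    other, and within each the quotient determines the block through [x] and [y]. *)
Lemma translated_pair_uniq (X Y : {set T}) (u v : T) : u != v ->
  X \in translated_blocks -> Y \in translated_blocks ->
  u \in X -> v \in X -> u \in Y -> v \in Y -> X = Y.
Proof.
case: u v => [x|i] [y|j] uv Xb Yb uX vX uY vY; last first.
- by rewrite (block_inr_inr Xb uv uX vX) (block_inr_inr Yb uv uY vY).
- by rewrite (block_inr_inl Xb uX vX) (block_inr_inl Yb uY vY).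
- by rewrite (block_inr_inl Xb vX uX) (block_inr_inl Yb vY uY).
have cancel_quot g : x * g^-1 * (y * g^-1)^-1 = x * y^-1.
  by rewrite invMg invgK mulgA mulgKV.
have F_excl B g : B \in F -> x * g^-1 \in B -> y * g^-1 \in B ->
    x * y^-1 \notin H /\ forall i, x * y^-1 <> t i.
  move=> BF xB yB; rewrite -(cancel_quot g); apply: F_diff BF xB yB _.
  by rewrite (inj_eq (mulIg _)).
have [[i xi XE]|[xH XE]|[B [g [BF xB yB XE]]]] := block_inl_inl Xb uv uX vX;
have [[j xj YE]|[yH YE]|[C [h [CF xC yC YE]]]] := block_inl_inl Yb uv uY vY.
- by rewrite XE YE; congr fix_line; apply: t_inj; rewrite -xi.
- by rewrite xi (negPf (tNH i)) in yH.
- by case: (F_excl _ _ CF xC yC) => _ /(_ i).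
- by rewrite xj (negPf (tNH j)) in xH.
- by rewrite XE YE.
- by case: (F_excl _ _ CF xC yC); rewrite xH.
- by case: (F_excl _ _ BF xB yB) => _ /(_ j).
- by case: (F_excl _ _ BF xB yB); rewrite yH.
have neq g' : x * g'^-1 != y * g'^-1 by rewrite (inj_eq (mulIg _)).
have [] := F_diff_inj BF CF xB yB (neq g) xC yC (neq h).
  by rewrite !cancel_quot.
by move=> BC /mulgI/invg_inj gh; rewrite XE YE BC gh.
Qed.

Lemma translated_pair_ex (u v : T) : u != v ->
  exists X : {set T}, [/\ X \in translated_blocks, u \in X & v \in X].
Proof.
have fixb i z : fix_line i z \in translated_blocks.
  by apply/translated_blocksP; constructor 2; exists i, z.
case: u v => [x|i] [y|j] uv; last first.
- exists infinity_block; rewrite !inr_infinity_block; split=> //.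
  by apply/translated_blocksP; constructor 1.
- by exists (fix_line i y); rewrite inr_fix_line inl_fix_line !eqxx.
- by exists (fix_line j x); rewrite inr_fix_line inl_fix_line !eqxx.
have [/existsP[i /eqP xi]|/existsPn nt] := boolP [exists i, x * y^-1 == t i].
  by exists (fix_line i y); rewrite !inl_fix_line eqxx -xi mulgKV eqxx orbT.
have [xH|xH] := boolP (x * y^-1 \in H).
  exists (finite_block (H :* y)); rewrite !mem_finite_block mem_rcoset xH.
  by rewrite rcoset_refl; split=> //; apply/translated_blocksP; constructor 3; exists y.
have [i|B [a [b [BF aB bB e]]]] := F_diff_ex xH; first exact/eqP/nt.
(* This translation sends [b] to [y], and therefore [a] to [x] because [a * b^-1 = x * y^-1]. *)
exists (finite_block (B :* (b^-1 * y))); rewrite !mem_finite_block !mem_rcoset.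
rewrite invMg invgK !mulgA e mulgKV mulgV mul1g; split=> //.
by apply/translated_blocksP; constructor 4; exists B, (b^-1 * y).
Qed.

(** * The classes partition the points, and the blocks are partitioned into classes *)

Lemma mem_translated_class g (X : {set T}) x :
  X \in translated_class g -> inl x \in X ->
  (exists2 i, x * g^-1 = r i \/ x * g^-1 = r i * t0 & X = fix_line i (r i * g)) \/
  exists B k, [/\ B \in F, k = 1 \/ k = t0, x * g^-1 * k \in B
                & X = finite_block (B :* (k * g))].
Proof.
case/translated_classP => [[i ->]|[B [k [BF kE ->]]]].
  rewrite inl_fix_line mulgA trE => /orP[] /eqP ->; left; exists i => //;
  by rewrite mulgK; auto.
rewrite mem_finite_block mem_rcoset invMg mulgA => xB; right; exists B, k.
by split=> //; case: kE xB => ->; rewrite ?invg1 ?t0V.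
Qed.

Lemma mulg_t0K x : x * t0 * t0 = x.
Proof. by rewrite -mulgA t0_sqr mulg1. Qed.

(** The conjugate [t i] of [t0] depends only on the left coset of [r i], and the [t i] are
    distinct. *)
Lemma t_coset i j : r i = r j \/ r i = r j * t0 -> i = j.
Proof.
move=> e; apply: t_inj; rewrite !tE; case: e => ->; first by [].
by rewrite mulg_t0K invMg t0V mulgA.
Qed.

(** Replacing [x] by [x * g^-1] reduces the claim to [g = 1], where it says that each left coset of
    [{1, t0}] has exactly one representative. *)
Lemma translated_class_partition g : partition (translated_class g) [set: T].
Proof.
apply: partition_intro.
- apply/negP => /translated_classP[[i /esym/eqP]|[B [k [BF _ /esym/eqP]]]].
    by rewrite -cards_eq0 card_fix_line.
  by rewrite -cards_eq0 card_finite_block card_rcoset F3.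
- by move=> X _; apply: subsetT.
- case=> [x|i] _; last first.
    exists (fix_line i (r i * g)); last by rewrite inr_fix_line.
    by apply/translated_classP; left; exists i.
  have [[i xE]|[B BF xB]] := res_ex (x * g^-1).
    exists (fix_line i (r i * g)); first by apply/translated_classP; left; exists i.
    rewrite inl_fix_line mulgA trE -{1}(mulgKV g x) -{2}(mulgKV g x).
    by case: xE => ->; rewrite eqxx ?orbT.
  have [k [kE kB]] : exists k, (k = 1 \/ k = t0) /\ x * g^-1 * k \in B.
    by case: xB => xB; [exists 1; rewrite mulg1 | exists t0]; auto.
  exists (finite_block (B :* (k * g))).
    by apply/translated_classP; right; exists B, k.
  rewrite mem_finite_block mem_rcoset invMg mulgA.
  by case: kE kB => ->; rewrite ?invg1 ?t0V.
move=> X Y [x|i] XC YC; last first.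
  case/translated_classP: XC => [[j ->]|[B [k [_ _ ->]]]];
    last by rewrite inr_finite_block.
  case/translated_classP: YC => [[l ->]|[B [k [_ _ ->]]]];
    last by rewrite inr_finite_block.
  by rewrite !inr_fix_line => /eqP<- /eqP<-.
have r_excl i B k : B \in F -> k = 1 \/ k = t0 ->
    x * g^-1 = r i \/ x * g^-1 = r i * t0 -> x * g^-1 * k \in B -> False.
  move=> BF kE xE; have [/negP r1 /negP r2] := res_r i BF.
  by case: kE => ->; case: xE => ->; rewrite ?mulg1 ?mulg_t0K.
move=> /(mem_translated_class XC)[[i xi ->]|[B [k [BF kE xB ->]]]];
move=> /(mem_translated_class YC)[[j xj ->]|[C [l [CF lE xC ->]]]].
- suff -> : i = j by [].
  apply: t_coset; case: xi => xi; case: xj => xj; rewrite xi in xj; auto.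
    by right; rewrite -xj mulg_t0K.
  by left; apply: (mulIg t0).
- by case: (r_excl i C l).
- by case: (r_excl j B k).
(* The cases [k = l] are settled by disjointness inside [F]; the mixed ones would give two
   representatives of one coset. *)
case: kE lE xB xC => [->|->] [->|->]; rewrite ?mulg1 => xB xC.
- by rewrite (res_disj BF CF xB xC).
- by case/negP: (res_t0 BF CF xB).
- by case/negP: (res_t0 CF BF xC).
by rewrite (res_disj BF CF xB xC).
Qed.

Lemma infinity_class_partition : partition infinity_class [set: T].
Proof.
apply: partition_intro.
- apply/negP => /infinity_classP[|[g]] /esym/eqP; rewrite -cards_eq0.
    by rewrite card_infinity_block.
  by rewrite card_finite_block card_rcoset card_H.
- by move=> X _; apply: subsetT.
- case=> [x|i] _.
    exists (finite_block (H :* x)); last by rewrite mem_finite_block rcoset_refl.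
    by apply/infinity_classP; right; exists x.
  by exists infinity_block; rewrite ?inr_infinity_block //; apply/infinity_classP; left.
move=> X Y [x|i] /infinity_classP[->|[g ->]] /infinity_classP[->|[h ->]] //;
  rewrite ?inl_infinity_block ?inr_finite_block // !mem_finite_block.
by move=> /rcoset_eqP <- /rcoset_eqP <-.
Qed.

(** Two points of [B] and their images in [C] have the same quotient, which occurs only once among
    the differences. *)
Lemma finite_block_F_inj B C g h : B \in F -> C \in F ->
  finite_block (B :* g) = finite_block (C :* h) -> B = C /\ g = h.
Proof.
move=> BF CF /finite_block_inj e.
have /eqP/cards3P[x [y [z [xy _ _ BE]]]] := F3 BF.
have [xB yB] : x \in B /\ y \in B by rewrite BE !inE !eqxx orbT.
have xC : x * g * h^-1 \in C by rewrite -mem_rcoset -e mem_rcoset mulgK.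
have yC : y * g * h^-1 \in C by rewrite -mem_rcoset -e mem_rcoset mulgK.
have [] := F_diff_inj BF CF xB yB xy xC yC.
- by rewrite !(inj_eq (mulIg _)).
- by rewrite !invMg invgK !mulgA mulgKV mulgK.
move=> -> /eqP; rewrite -mulgA -{1}(mulg1 x) (inj_eq (mulgI x)) eq_sym.
by rewrite -eq_mulgV1 => /eqP.
Qed.

(** A translate of a block of [F] that is a right coset of [H] would have its differences in [H]. *)
Lemma infinity_class_F X g : X \in infinity_class -> X \in translated_class g -> False.
Proof.
case/infinity_classP => [->|[h ->]] /translated_classP[[i e]|[B [k [BF _ e]]]].
- by have := inl_infinity_block (r i * g); rewrite e inl_fix_line eqxx.
- by have := inr_infinity_block ord0; rewrite e inr_finite_block.
- by have := inr_finite_block (H :* h) i; rewrite e inr_fix_line eqxx.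
have /eqP/cards3P[x [y [z [xy _ _ BE]]]] := F3 BF.
have [xB yB] : x \in B /\ y \in B by rewrite BE !inE !eqxx orbT.
have inH w : w \in B -> w * (k * g) * h^-1 \in H.
  by move=> wB; rewrite -mem_rcoset (finite_block_inj e) mem_rcoset mulgK.
have [/negP[]] := F_diff BF xB yB xy.
have := groupM (inH x xB) (groupVr (inH y yB)).
by move: (k * g) => c; rewrite !invMg invgK !mulgA mulgKV mulgK.
Qed.

Lemma translated_classes_partition : partition translated_classes translated_blocks.
Proof.
apply: partition_intro.
- apply/negP => /translated_classesP[|[g]] e.
    have : infinity_block \in infinity_class by apply/infinity_classP; left.
    by rewrite -e inE.
  have : fix_line ord0 (r ord0 * g) \in translated_class g.
    by apply/translated_classP; left; exists ord0.
  by rewrite -e inE.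
- by move=> C Cc; apply: bigcup_sup.
- by move=> X /bigcupP[C Cc XC]; exists C.
move=> C D X /translated_classesP[->|[g ->]] /translated_classesP[->|[h ->]] //.
- by move=> X1 X2; case: (infinity_class_F X1 X2).
- by move=> X1 X2; case: (infinity_class_F X2 X1).
(* A common block forces the two parameters to agree up to a left factor [t0], which
   [translated_class_t0] absorbs. *)
suff key : g = h \/ g = t0 * h -> translated_class g = translated_class h.
  case/translated_classP => [[i ->]|[B [k [BF kE ->]]]].
    case/translated_classP => [[j e]|[C' [l [_ _ e]]]]; last first.
      by have := inr_finite_block (C' :* (l * h)) i; rewrite -e inr_fix_line eqxx.
    have ij : i = j by apply/eqP; rewrite -(inr_fix_line _ _ (r j * h)) -e inr_fix_line.
    subst j; have : inl (r i * g) \in fix_line i (r i * h).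
      by rewrite -e inl_fix_line eqxx.
    rewrite inl_fix_line mulgA trE -mulgA !(inj_eq (mulgI _)).
    by case/orP=> /eqP ge; apply: key; auto.
  case/translated_classP => [[j e]|[C' [l [CF lE e]]]].
    by have := inr_finite_block (B :* (k * g)) j; rewrite e inr_fix_line eqxx.
  have [_ kl] := finite_block_F_inj BF CF e; apply: key.
  case: kE lE kl => [->|->] [->|->]; rewrite ?mul1g; auto.
    by move=> <-; right; rewrite mulgA t0_sqr mul1g.
  by move/mulgI; auto.
by case=> ->; rewrite ?translated_class_t0.
Qed.

Lemma translated_KTS : KTS (#|gT| + 3) translated_blocks translated_classes.
Proof.
split.
- by rewrite card_sum card_ord.
- exact: card_translated_block.
- move=> u v uv; have [X [Xb uX vX]] := translated_pair_ex uv.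
  by exists X; split=> // Y [Yb uY vY]; apply: translated_pair_uniq uv _ _ _ _ _ _.
- exact: translated_classes_partition.
move=> C /translated_classesP[->|[g ->]].
  exact: infinity_class_partition.
exact: translated_class_partition.
Qed.

(** * The right translations form a 3-pyramidal automorphism group *)

Lemma translation_class s g :
  [set translation s @: (B : {set T}) | B in translated_class g]
    = translated_class (g * s).
Proof.
rewrite /translated_class !imsetU -!imset_comp; congr (_ :|: (_ :|: _)).
- by apply: eq_imset => i /=; rewrite translation_fix_line mulgA.
- by apply: eq_imset => B /=; rewrite translation_finite_block -rcosetM.
by apply: eq_imset => B /=; rewrite translation_finite_block -rcosetM mulgA.
Qed.

Lemma translation_infinity_class s :
  [set translation s @: (B : {set T}) | B in infinity_class] = infinity_class.
Proof.
rewrite /infinity_class imsetU1 translation_infinity_block -imset_comp.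
congr (_ |: _); apply/setP => X; apply/imsetP/imsetP => -[g _ ->].
  by exists (g * s); rewrite //= translation_finite_block -rcosetM.
by exists (g * s^-1); rewrite //= translation_finite_block -rcosetM mulgKV.
Qed.

Lemma translation_automorphism s :
  KTS_automorphism translated_blocks translated_classes (translation s).
Proof.
have autC (C : {set {set T}}) : C \in translated_classes ->
    [set translation s @: (B : {set T}) | B in C] \in translated_classes.
  move=> /translated_classesP[->|[g ->]]; apply/translated_classesP.
    by left; rewrite translation_infinity_class.
  by right; exists (g * s); rewrite translation_class.
split=> // X /bigcupP[C /autC Cc XC].
apply/bigcupP; exists [set translation s @: (B : {set T}) | B in C] => //.
exact: imset_f.
Qed.

Lemma translations_group_set : group_set [set translation g | g : gT].
Proof.
apply/group_setP; split; first by apply/imsetP; exists 1; rewrite ?translation1.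
move=> _ _ /imsetP[g _ ->] /imsetP[h _ ->].
by apply/imsetP; exists (g * h); rewrite ?translationM.
Qed.

Lemma translated_three_pyramidal : three_pyramidal translated_blocks translated_classes.
Proof.
pose A := Group translations_group_set.
have FxE : 'Fix_'P(A) = infinity_block.
  apply/setP => -[x|i].
    rewrite inl_infinity_block; apply/afixP => /(_ (translation t0)).
    rewrite imset_f // => /(_ isT) /=; rewrite /aperm permE => -[] /eqP.
    by rewrite -{2}(mulg1 x) (inj_eq (mulgI x)) (negPf t0_neq1).
  rewrite inr_infinity_block; apply/afixP => _ /imsetP[g _ ->] /=.
  by rewrite /aperm permE.
exists A; rewrite FxE; split.
- by move=> _ /imsetP[g _ ->]; apply: translation_automorphism.
- exact: card_infinity_block.
case=> [x|i]; last by rewrite inr_infinity_block.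
move=> [y|j] _; last by rewrite inr_infinity_block.
move=> _; exists (translation (x^-1 * y)); split.
  by rewrite permE /= mulKVg; split=> //; apply: imset_f.
by move=> _ [/imsetP[g _ ->]]; rewrite permE /= => -[<-]; rewrite mulKg.
Qed.

End FromDifferenceFamily.

(** * The construction for a subgroup [G] of an arbitrary group type *)

Lemma difference_family_pyramidal_KTS (gT : finGroupType) (G J : {group gT})
    (F : seq {set gT}) :
  difference_family G F -> J \subset G -> #|J| = 2 -> resolvable G J F ->
  exists (T : finType) (blocks : {set {set T}}) (classes : {set {set {set T}}}),
    KTS (#|G| + 3) blocks classes /\ three_pyramidal blocks classes.
Proof.
move=> [FG [Sigma [SG cS cS2 cS3 _] DF]] sJG J2 [a [b [aG bG J3 [PhiG cnt]]]].
have [u0 ou0 JE] := group2P J2; subst J.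
rewrite cycle_subG in sJG; rename sJG into u0G.
have u01 : u0 != 1 by rewrite -order_eq1 ou0.
have u0u0 : u0 * u0 = 1 by have := expg_order u0; rewrite ou0 expgS expg1.
set tl := [:: 1; a; b] in PhiG cnt.
pose r (i : 'I_3) := nth 1 tl i.
have r_tl i : r i \in tl by rewrite mem_nth.
have tlP y : y \in tl -> exists i, y = r i.
  by case/(nthP 1) => i lti <-; exists (Ordinal lti).
have rG i : r i \in G by apply: PhiG; rewrite mem_cat r_tl orbT.
pose u i := u0 ^ (r i)^-1.
have uG i : u i \in G by rewrite groupJ ?groupV.
have ou i : #[u i] = 2 by rewrite orderJ.
set L := [:: _; _; _] in J3.
(* [L] and [tl] are listed in the same order; at the first index [r i] is 1 and the conjugation is
   trivial. *)
have nthL (i : 'I_3) : nth <[u0]>%G L i = <[u i]>%G.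
  apply: val_inj; case: i => [[|[|[|//]]] lti] /=; rewrite /u /r /= cycleJ //.
  by rewrite invg1 conjsg1.
have uL : uniq L by rewrite (perm_uniq J3) enum_uniq.
have u_inj : injective u.
  move=> i j e; apply/val_inj/eqP.
  by rewrite -(@nth_uniq _ <[u0]>%G L i j (ltn_ord i) (ltn_ord j) uL) !nthL e.
have sub2 (S : {group gT}) : S \subset G -> #|S| = 2 -> exists i, S = <[u i]>%G.
  move=> sSG S2; have : S \in L by rewrite (perm_mem J3) mem_enum inE sSG S2.
  by case/(nthP <[u0]>%G) => i lti <-; exists (Ordinal lti); rewrite -nthL.
set S2 := [set S in _ | _] in cS2; set S3 := [set S in _ | _] in cS3.
have /eqP/cards1P[H HE] := cS3.
have [HS H3] : H \in Sigma /\ #|H| = 3.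
  have : H \in S3 by rewrite HE inE.
  by rewrite inE => /andP[-> /eqP].
(* [Sigma] has three subgroups of order 2 and [G] has only three, so all of them are in [Sigma]. *)
have uS i : <[u i]>%G \in Sigma.
  suff : <[u i]>%G \in S2 by rewrite inE => /andP[].
  suff -> : S2 = subgroups2 G by rewrite inE /= cycle_subG uG -orderE ou.
  apply/eqP; rewrite eqEcard; apply/andP; split.
    by apply/subsetP => S; rewrite !inE => /andP[/SG-> ->].
  by rewrite cS2 cardE -(perm_size J3).
(* The three subgroups of order 2 and the one of order 3 already exhaust the four members of
   [Sigma]. *)
have SigmaE S : S \in Sigma -> S = H \/ exists i, S = <[u i]>%G.
  have /eqP <- : S2 :|: S3 == Sigma.
    rewrite eqEcard cS cardsU cS2 cS3; apply/andP; split.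
      by apply/subsetP => S'; rewrite !inE => /orP[] /andP[].
    suff -> : S2 :&: S3 = set0 by rewrite cards0.
    by apply/setP => S'; rewrite !inE; case: (#|S'| =P 2) => [->|_]; rewrite !andbF.
  rewrite inE => /orP[|]; last by rewrite HE inE => /eqP->; left.
  by rewrite inE => /andP[/SG sSG /eqP S2']; right; apply: sub2.
have diffP d : (d \in DeltaF F) = [&& d \in G, d \notin H & [forall i, d != u i]].
  rewrite (perm_mem DF) mem_enum in_setD andbC; congr (_ && _).
  apply/idP/andP => [dS|[dH /forallP du]].
    split; first by apply: contra dS => dH; apply/bigcupP; exists H.
    apply/forallP => i; apply: contraNneq dS => ->; apply/bigcupP.
    by exists <[u i]>%G; rewrite //= cycle_id.
  apply/negP => /bigcupP[S /SigmaE[->|[i ->]]]; first exact/negP.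
  rewrite mem_cycle2 // (negPf (du i)) orbF => /eqP d1.
  by rewrite d1 group1 in dH.
have uDF : uniq (DeltaF F) by rewrite (perm_uniq DF) enum_uniq.
have cntG x : x \in G -> count [in x *: <[u0]>] (Phi F ++ tl) = 1%N.
  by move=> xG; apply: cnt; apply/lcosetsP; exists x.
have memJ x y : (y \in x *: <[u0]>) = (y == x) || (y == x * u0).
  by rewrite mem_lcoset mem_cycle2 // -eq_invg_mul invgK eq_sym
    -(inj_eq (mulgI x) _ u0) mulKVg.
have memPhi B x : B \in F -> x \in B -> x \in Phi F.
  by move=> BF xB; apply/flatten_mapP; exists B; rewrite ?mem_enum.
(* The points of the construction are a whole group type, so everything is pulled back along [sgval]
   to [[subg G]]. *)
pose H' := (sgval @*^-1 H)%G : {group [subg G]}.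
have memH' d : (d \in H') = (sgval d \in H) by rewrite !inE.
pose F' := [set sgval @^-1: (B : {set gT}) | B in F] : {set {set [subg G]}}.
have F'P (B' : {set [subg G]}) :
    B' \in F' -> exists2 B, B \in F & B' = sgval @^-1: B.
  by case/imsetP=> B BF ->; exists B.
have sgE (B : {set gT}) (x : [subg G]) : (x \in sgval @^-1: B) = (sgval x \in B).
  by rewrite inE.
have sgK x : x \in G -> sgval (subg G x) = x by apply: subgK.
have sgM (x y : [subg G]) : sgval (x * y) = sgval x * sgval y by [].
have sgV (x y : [subg G]) : sgval (x * y^-1) = sgval x * (sgval y)^-1 by [].
have sgI := @subg_inj _ G.
have cH' : #|H'| = 3.
  rewrite -(card_injm (injm_sgval G)) ?subsetT // morphpreK ?im_sgval //.
  exact: SG.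
have -> : #|G| = #|{: subg_of G}|.
  by rewrite -cardsT -(card_injm (injm_sgval G)) ?subsetT ?im_sgval.
exists ([subg G] + 'I_3)%type,
  (translated_blocks (subg G u0) (subg G \o u) (subg G \o r) H' F'),
  (translated_classes (subg G u0) (subg G \o u) (subg G \o r) H' F').
have t0_neq1 : subg G u0 != 1.
  by apply: contra u01 => /eqP/(congr1 sgval); rewrite sgK //= => ->.
have t0_sqr : subg G u0 * subg G u0 = 1 by apply: sgI; rewrite sgM sgK.
have trE i : subg G (u i) * subg G (r i) = subg G (r i) * subg G u0.
  by apply: sgI; rewrite !sgM !sgK // /u conjgE invgK mulgA mulgKV.
have t_inj : injective (subg G \o u).
  by move=> i j /(congr1 sgval); rewrite /= !sgK // => /u_inj.
have tNH i : subg G (u i) \notin H'.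
  rewrite memH' sgK //; apply/negP => /order_dvdG.
  by rewrite ou H3.
have F3 B : B \in F' -> #|B| = 3.
  case/F'P => C CF ->; have [sCG <-] := FG C CF.
  rewrite -(card_imset _ sgI); apply: eq_card => x.
  apply/imsetP/idP => [[y]|xC]; first by rewrite sgE => yC ->.
  by exists (subg G x); rewrite ?sgE sgK ?(subsetP sCG).
have F_diff B x y : B \in F' -> x \in B -> y \in B -> x != y ->
    x * y^-1 \notin H' /\ forall i, x * y^-1 <> subg G (u i).
  move=> /F'P[C CF ->]; rewrite !sgE => xC yC xy.
  have : sgval x * (sgval y)^-1 \in DeltaF F.
    by apply/DeltaFP; exists C, (sgval x), (sgval y); rewrite (inj_eq sgI).
  rewrite diffP => /and3P[_ dH /forallP du]; rewrite memH' sgV; split=> // i.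
  by move/(congr1 sgval); rewrite sgV sgK // => /eqP; apply/negP.
have F_diff_ex d : d \notin H' -> (forall i, d <> subg G (u i)) ->
    exists B x y, [/\ B \in F', x \in B, y \in B & d = x * y^-1].
  rewrite memH' => dH du; have : sgval d \in DeltaF F.
    rewrite diffP subgP dH; apply/forallP => i; apply/eqP => e; apply: (du i).
    by apply: sgI; rewrite sgK.
  case/DeltaFP => B [x [y [BF xB yB _ e]]].
  have [[/subsetP sBG _]] := FG B BF.
  exists (sgval @^-1: B), (subg G x), (subg G y); rewrite !sgE !sgK ?sBG //.
  split=> //; first exact: imset_f.
  by apply: sgI; rewrite sgV !sgK ?sBG.
have F_diff_inj B C x y z w : B \in F' -> C \in F' ->
    x \in B -> y \in B -> x != y -> z \in C -> w \in C -> z != w ->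
    x * y^-1 = z * w^-1 -> B = C /\ x = z.
  move=> /F'P[B1 BF ->] /F'P[C1 CF ->]; rewrite !sgE => xB yB xy zC wC zw e.
  have [] := uniq_DeltaF_inj uDF BF CF xB yB _ zC wC.
  - by rewrite (inj_eq sgI).
  - by rewrite (inj_eq sgI).
  - by rewrite -!sgV e.
  by move=> -> /sgI.
have res_ex x : (exists i, x = subg G (r i) \/ x = subg G (r i) * subg G u0) \/
    (exists2 B, B \in F' & x \in B \/ x * subg G u0 \in B).
  have : has [in sgval x *: <[u0]>] (Phi F ++ tl) by rewrite has_count cntG ?subgP.
  case/hasP => y ys; rewrite /= memJ => yx.
  have {yx}yx : sgval x = y \/ sgval x = y * u0.
    case/orP: yx => /eqP->; [by left | right].
    by rewrite -mulgA u0u0 mulg1.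
  move: ys; rewrite mem_cat => /orP[/flatten_mapP[B BF]|/tlP[i yr]]; last first.
    left; exists i; case: yx => yx; [left | right]; apply: sgI.
      by rewrite sgK // -yr.
    by rewrite sgM !sgK // -yr.
  rewrite mem_enum => yB; right; exists (sgval @^-1: B); first exact: imset_f.
  rewrite !sgE sgM sgK //; case: yx => ->; [by left | right].
  by rewrite -mulgA u0u0 mulg1.
have Phi_eq x y : x \in G -> x \in Phi F ++ tl -> y \in Phi F ++ tl ->
    y \in x *: <[u0]> -> x = y.
  move=> xG xs ys yx; apply: (@count_le1_eq _ [in x *: <[u0]>] (Phi F ++ tl)) => //.
    by rewrite cntG.
  by rewrite /= lcoset_refl.
have res_r B i : B \in F' -> subg G (r i) \notin B /\ subg G (r i) * subg G u0 \notin B.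
  case/F'P => C CF ->; rewrite !sgE sgM !sgK //.
  (* A block meeting the coset of [r i] would add a representative from [Phi F] to the one in [tl],
     making the count at least 2. *)
  have key y : y \in C -> y \in r i *: <[u0]> -> False.
    move=> yC yJ; have := cntG _ (rG i); rewrite count_cat => e.
    have c1 : 0 < count [in r i *: <[u0]>] (Phi F).
      by rewrite -has_count; apply/hasP; exists y; rewrite // (memPhi C).
    have c2 : 0 < count [in r i *: <[u0]>] tl.
      by rewrite -has_count; apply/hasP; exists (r i); rewrite //= lcoset_refl.
    by have := leq_add c1 c2; rewrite e.
  by split; apply/negP => /key; apply; rewrite memJ eqxx ?orbT.
have res_disj B C x : B \in F' -> C \in F' -> x \in B -> x \in C -> B = C.
  move=> /F'P[B1 BF ->] /F'P[C1 CF ->]; rewrite !sgE => xB xC.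
  suff -> : B1 = C1 by [].
  have hasx D : sgval x \in D -> has [in sgval x *: <[u0]>] (enum D).
    move=> xD; apply/hasP; exists (sgval x); rewrite ?mem_enum //.
    by rewrite /= lcoset_refl.
  apply: (@count_flatten_map_le1 _ _ (fun B : {set gT} => enum B)
    [in sgval x *: <[u0]>] F) => //; try exact: hasx.
  by rewrite -(cntG (sgval x)) ?subgP // count_cat leq_addr.
have res_t0 B C x : B \in F' -> C \in F' -> x \in B -> x * subg G u0 \notin C.
  move=> /F'P[B1 BF ->] /F'P[C1 CF ->]; rewrite !sgE sgM sgK // => xB.
  apply/negP => xC; have := Phi_eq (sgval x) (sgval x * u0) (subgP x).
  rewrite !mem_cat (memPhi B1) // (memPhi C1) // memJ eqxx orbT.
  move=> /(_ isT isT isT)/eqP; rewrite -{1}(mulg1 (sgval x)) (inj_eq (mulgI _)).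
  by rewrite eq_sym (negPf u01).
split.
  exact: translated_KTS t0_neq1 t0_sqr trE t_inj cH' tNH F3 F_diff F_diff_ex
    F_diff_inj res_ex res_r res_disj res_t0.
exact: translated_three_pyramidal.
Qed.

Local Close Scope group_scope.

Theorem theorem3p8 (n : nat) (n_gt0 : 0 < n) :
  (exists (T : finType) (blocks : {set {set T}}) (classes : {set {set {set T}}}),
     KTS (6 * n + 3) blocks classes /\ three_pyramidal blocks classes)
  <->
  (exists (gT : finGroupType) (G : {group gT}),
     [/\ pertinent G, #|G| = 6 * n
       & exists2 F : seq {set gT}, difference_family G F
         & exists J : {group gT},
             [/\ J \subset G, #|J| = 2 & resolvable G J F]]).
Proof.
split=> [[T [blocks [classes [kts pyr]]]]|[gT [G [_ cG [F dF [J [sJG J2 res]]]]]]].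
  exact: pyramidal_KTS_difference_family n_gt0 kts pyr.
by rewrite -cG; apply: difference_family_pyramidal_KTS dF sJG J2 res.
Qed.
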